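(* Let $n\ge 2$ agents communicate over an undirected connected weighted graph with Laplacian $L$. Let $f_1,\dots,f_n:\mathbb{R}^d\to\mathbb{R}$ be differentiable with $\|\nabla f_i(x)-\nabla f_i(y)\|\le L_f\|x-y\|$ for all $x,y\in\mathbb{R}^d$, $i\in[n]$, where $L_f>0$. Let $f=\frac1n\sum_{i=1}^n f_i$ and assume that $f^*=\min_{x\in\mathbb{R}^d}f(x)$ is finite. Let $\mathcal{C}:\mathbb{R}^d\to\mathbb{R}^d$ be a (possibly random) compressor such that, for some constants $\varphi\in(0,1]$ and $r>0$, $\mathbf{E}_{\mathcal C}\big[\|\mathcal{C}(x)/r-x\|^2\big]\le(1-\varphi)\|x\|^2$ for all $x\in\mathbb{R}^d$. Let $\{x_{i,k}\}$ be generated by Algorithm 1 (see context) with $\alpha=\kappa_1\beta$, $\beta>\kappa_2$, $\eta\in(0,\kappa_3)$ and $\psi\in(0,1/r]$, where $\kappa_1,\kappa_2,\kappa_3$ are the positive constants defined in the context. Let $\bar x_k=\frac1n\sum_{i=1}^n x_{i,k}$. Then, for any $T\in\mathbb{N}_0$, $$\sum_{k=0}^{T}\sum_{i=1}^{n}\mathbf{E}_{\mathcal{C}}\big[\|x_{i,k}-\bar{x}_k\|^2+\|\nabla f(\bar{x}_k)\|^2\big]=\mathcal{O}(1),\qquad \mathbf{E}_{\mathcal{C}}[f(\bar{x}_{T})-f^*]=\mathcal{O}(1),$$ where $\mathcal{O}(1)$ means bounded by a constant independent of $T$.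
   Context: Notation: $\mathbb{N}_0$ is the set of nonnegative integers, $[n]=\{1,\dots,n\}$, $\|\cdot\|$ is the Euclidean norm. The graph has symmetric weighted adjacency matrix $A=(a_{ij})$, $a_{ij}\ge0$, $a_{ii}=0$; $(i,j)$ is an edge iff $a_{ij}>0$; $L=(L_{ij})=\mathrm{diag}(\sum_j a_{1j},\dots,\sum_j a_{nj})-A$. $\rho(L)$ is the spectral radius of $L$ and $\rho_2(L)$ its smallest positive eigenvalue. $\mathbf{E}_{\mathcal C}$ is expectation over the internal randomness of the compressor; each application of $\mathcal C$ uses fresh randomness, so the compressor inequality holds conditionally on the past. Algorithm 1: positive parameters $\alpha,\beta,\eta,\psi$. Initialize with arbitrary (deterministic) $x_{i,0}\in\mathbb{R}^d$, $a_{i,0}=b_{i,0}=v_{i,0}=\mathbf 0_d$, $q_{i,0}=\mathcal C(x_{i,0})$. For $k=0,1,\dots$ and all $i\in[n]$: $a_{i,k+1}=a_{i,k}+\psi q_{i,k}$; $b_{i,k+1}=b_{i,k}+\psi\big(q_{i,k}-\sum_{j=1}^nL_{ij}q_{j,k}\big)$; $x_{i,k+1}=x_{i,k}-\eta\alpha\big(a_{i,k}-b_{i,k}+\sum_{j=1}^nL_{ij}q_{j,k}\big)-\eta(\beta v_{i,k}+\nabla f_i(x_{i,k}))$; $v_{i,k+1}=v_{i,k}+\eta\beta\big(a_{i,k}-b_{i,k}+\sum_{j=1}^nL_{ij}q_{j,k}\big)$; $q_{i,k+1}=\mathcal C(x_{i,k+1}-a_{i,k+1})$. Constants: $r_0=2r^2(1-\varphi)+2(1-r)^2$.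 $\kappa_4>0$ is any constant; $\kappa_1$ is any constant with $\kappa_1\ge\max\{\frac{9+\kappa_4}{2\rho_2(L)},1\}$; $\kappa_5=\max\{\frac{4+5L_f^2}{\kappa_4},\frac{6}{\rho_2(L)}\}$; $\kappa_6=\frac{8(\kappa_1+1)^2L_f^2}{\kappa_5\rho_2(L)}+\frac{4L_f^2}{\rho_2^2(L)}$; $\kappa_2=\max\{\kappa_5,\sqrt{\kappa_6}\}$; $\kappa_3=\min\Big\{\frac{\epsilon_1}{\epsilon_2},\frac{\epsilon_3}{\epsilon_4},\frac{\epsilon_5}{\epsilon_6},\frac{\sqrt{\epsilon_8^2+4\epsilon_7\epsilon_9}-\epsilon_8}{2\epsilon_9}\Big\}$ (the last term is omitted if $r_0=0$), with $\epsilon_1=\frac{\alpha}{2}\rho_2(L)-\frac14(9\beta+4+5L_f^2)$, $\epsilon_2=3L_f^2+\frac{4(2+\varphi\psi r)}{\varphi\psi r}(\alpha^2\rho^2(L)+L_f^2)+2\beta^2+1+3\alpha^2\rho^2(L)$, $\epsilon_3=\frac{\beta}{2}-3\rho_2^{-1}(L)$, $\epsilon_4=2\beta^2\rho(L)+\frac{4(2+\varphi\psi r)\beta^2\rho^2(L)}{\varphi\psi r}+\rho_2^{-1}(L)$, $\epsilon_5=\frac18-\frac{(\alpha+\beta)^2L_f^2}{\beta^5\rho_2(L)}-\frac{L_f^2}{2\beta^2\rho_2^2(L)}$, $\epsilon_6=\frac{(\alpha+\beta)L_f^2}{2\beta^3\rho_2(L)}+\frac{3L_f^2}{4}+\frac{L_f^2}{2\beta^2\rho_2^2(L)}+\frac{L_f}{2}$,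 $\epsilon_7=\frac{\varphi\psi r}{2}(1+\varphi\psi r)$, $\epsilon_8=\frac12(\alpha+2\beta)\rho(L)r_0+2\beta r_0$, $\epsilon_9=\frac{(8+7\varphi\psi r)\alpha^2\rho^2(L)r_0}{\varphi\psi r}+(2\beta^2+1)r_0$. *)

(* Defs.v *)
From HB Require Import structures.
From mathcomp Require Import all_boot all_order all_algebra.
From mathcomp Require Import finmap.
From mathcomp Require Import complex.
From mathcomp Require Import all_classical all_reals all_analysis.

Set Implicit Arguments.
Unset Strict Implicit.
Unset Printing Implicit Defensive.

Import Order.TTheory GRing.Theory Num.Theory.
Import numFieldNormedType.Exports.

Local Open Scope classical_set_scope.
Local Open Scope ring_scope.

(* The library norm `|x| on 'rV[R]_d is the sup norm, hence this definition. *)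
Definition enorm (R : realType) (d : nat) (x : 'rV[R]_d) : R :=
  Num.sqrt (\sum_(j < d) x 0 j ^+ 2).

Definition grad (R : realType) (d : nat) (f : 'rV[R]_d -> R) (x : 'rV[R]_d) :
  'rV[R]_d := \row_(j < d) 'D_(delta_mx 0 j) f x.

Definition is_minimum (R : realType) (U : Type) (f : U -> R) (m : R) : Prop :=
  (exists x, f x = m) /\ forall x, m <= f x.

Definition mean_fun (R : realType) (n d : nat) (f : 'I_n -> 'rV[R]_d -> R) :
  'rV[R]_d -> R := fun y => n%:R^-1 * \sum_(i < n) f i y.

Definition mean_vec (R : realType) (n d : nat) (x : 'I_n -> 'rV[R]_d) :
  'rV[R]_d := n%:R^-1 *: \sum_(i < n) x i.

(* Weighted adjacency matrix of an undirected connected weighted graph without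
   loops; (i, j) is an edge iff 0 < A i j. *)
Definition connected_weighted_graph (R : realType) (n : nat) (A : 'M[R]_n) :
  Prop :=
  [/\ A^T = A,
      forall i j, 0 <= A i j,
      forall i, A i i = 0 &
      forall i j, connect [rel i j | 0 < A i j] i j].

Definition laplacian (R : realType) (n : nat) (A : 'M[R]_n) : 'M[R]_n :=
  diag_mx (\row_(i < n) \sum_(j < n) A i j) - A.

Definition spectral_radius (R : realType) (n : nat) (M : 'M[R]_n) : R :=
  sup [set Normc.normc z | z in
    [set z : R[i] | eigenvalue (map_mx (real_complex R) M) z]].

(* The set is finite, so for a matrix with a positive eigenvalue the infimum is
   attained and is the smallest positive eigenvalue. *)
Definition min_pos_eigenvalue (R : realType) (n : nat) (M : 'M[R]_n) : R :=
  inf [set a : R | eigenvalue M a /\ 0 < a].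

Definition mutually_independent (R : realType) (dO dS : measure_display)
    (Omega : measurableType dO) (S : measurableType dS)
    (P : probability Omega R) (I : choiceType) (X : I -> Omega -> S) : Prop :=
  forall (J : {fset I}) (B : I -> set S),
    (forall i, measurable (B i)) ->
    P (\bigcap_(i in [set` J]) (X i @^-1` B i)) =
    (\prod_(i <- J) P (X i @^-1` B i))%E.

(* A random map is a map C with an extra argument, a seed of law mu. Its joint
   measurability is expressed through the product sigma-algebra on d.-tuple R,
   that is, the Borel sigma-algebra of R^d. *)
Definition compressor (R : realType) (d : nat) (dS : measure_display)
    (S : measurableType dS) (mu : probability S R)
    (C : S -> 'rV[R]_d -> 'rV[R]_d) (phi r : R) : Prop :=
  (forall j : 'I_d, measurable_fun [set: S * d.-tuple R]
     (fun p : S * d.-tuple R => C p.1 (\row_(l < d) tnth p.2 l) 0 j)) /\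
  (forall x : 'rV[R]_d,
     ('E_mu[fun s => (enorm (r^-1 *: C s x - x) ^+ 2)%R] <=
      ((1 - phi) * enorm x ^+ 2)%:E)%E).

(* xi i k is the seed of the application of the compressor producing q_{i,k}:
   the seeds have law mu and are jointly independent. *)
Definition fresh_seeds (R : realType) (n : nat) (dO dS : measure_display)
    (Omega : measurableType dO) (S : measurableType dS)
    (P : probability Omega R) (mu : probability S R)
    (xi : 'I_n -> nat -> Omega -> S) : Prop :=
  [/\ forall i k, measurable_fun [set: Omega] (xi i k),
      forall i k (B : set S), measurable B -> P (xi i k @^-1` B) = mu B &
      mutually_independent P (fun ik : 'I_n * nat => xi ik.1 ik.2)].

(* One trajectory; Q i k is the realization of the compressor that produces
   q i k. *)
Record compressed_primal_dual (R : realType) (n d : nat) (L : 'M[R]_n)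
    (f : 'I_n -> 'rV[R]_d -> R) (alpha beta eta psi : R)
    (Q : 'I_n -> nat -> 'rV[R]_d -> 'rV[R]_d) (x0 : 'I_n -> 'rV[R]_d)
    (a b v x q : 'I_n -> nat -> 'rV[R]_d) : Prop := CompressedPrimalDual {
  x_init : forall i, x i 0%N = x0 i;
  a_init : forall i, a i 0%N = 0;
  b_init : forall i, b i 0%N = 0;
  v_init : forall i, v i 0%N = 0;
  q_init : forall i, q i 0%N = Q i 0%N (x0 i);
  a_step : forall i k, a i k.+1 = a i k + psi *: q i k;
  b_step : forall i k,
    b i k.+1 = b i k + psi *: (q i k - \sum_(j < n) L i j *: q j k);
  x_step : forall i k,
    x i k.+1 = x i k
      - (eta * alpha) *: (a i k - b i k + \sum_(j < n) L i j *: q j k)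
      - eta *: (beta *: v i k + grad (f i) (x i k));
  v_step : forall i k,
    v i k.+1 = v i k
      + (eta * beta) *: (a i k - b i k + \sum_(j < n) L i j *: q j k);
  q_step : forall i k, q i k.+1 = Q i k.+1 (x i k.+1 - a i k.+1)
}.

Section constants.
Context {R : realType}.

(* rho and rho2 stand for the spectral radius and the smallest positive
   eigenvalue of the Laplacian, Lf for the common Lipschitz constant of the
   gradients. *)

Definition kappa1_bound (rho2 kappa4 : R) : R :=
  Num.max ((9 + kappa4) / (2 * rho2)) 1.

Definition kappa5 (rho2 Lf kappa4 : R) : R :=
  Num.max ((4 + 5 * Lf ^+ 2) / kappa4) (6 / rho2).

Definition kappa6 (rho2 Lf kappa1 kappa4 : R) : R :=
  8 * (kappa1 + 1) ^+ 2 * Lf ^+ 2 / (kappa5 rho2 Lf kappa4 * rho2)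
  + 4 * Lf ^+ 2 / rho2 ^+ 2.

Definition kappa2 (rho2 Lf kappa1 kappa4 : R) : R :=
  Num.max (kappa5 rho2 Lf kappa4) (Num.sqrt (kappa6 rho2 Lf kappa1 kappa4)).

Definition r_zero (phi r : R) : R :=
  2 * r ^+ 2 * (1 - phi) + 2 * (1 - r) ^+ 2.

Definition eps1 (rho2 Lf alpha beta : R) : R :=
  alpha / 2 * rho2 - 1 / 4 * (9 * beta + 4 + 5 * Lf ^+ 2).

Definition eps2 (rho Lf phi r alpha beta psi : R) : R :=
  3 * Lf ^+ 2
  + 4 * (2 + phi * psi * r) / (phi * psi * r)
    * (alpha ^+ 2 * rho ^+ 2 + Lf ^+ 2)
  + 2 * beta ^+ 2 + 1 + 3 * alpha ^+ 2 * rho ^+ 2.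

Definition eps3 (rho2 beta : R) : R := beta / 2 - 3 * rho2^-1.

Definition eps4 (rho rho2 phi r beta psi : R) : R :=
  2 * beta ^+ 2 * rho
  + 4 * (2 + phi * psi * r) * beta ^+ 2 * rho ^+ 2 / (phi * psi * r)
  + rho2^-1.

Definition eps5 (rho2 Lf alpha beta : R) : R :=
  1 / 8 - (alpha + beta) ^+ 2 * Lf ^+ 2 / (beta ^+ 5 * rho2)
  - Lf ^+ 2 / (2 * beta ^+ 2 * rho2 ^+ 2).

Definition eps6 (rho2 Lf alpha beta : R) : R :=
  (alpha + beta) * Lf ^+ 2 / (2 * beta ^+ 3 * rho2)
  + 3 * Lf ^+ 2 / 4 + Lf ^+ 2 / (2 * beta ^+ 2 * rho2 ^+ 2) + Lf / 2.

Definition eps7 (phi r psi : R) : R :=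
  phi * psi * r / 2 * (1 + phi * psi * r).

Definition eps8 (rho phi r alpha beta : R) : R :=
  1 / 2 * (alpha + 2 * beta) * rho * r_zero phi r + 2 * beta * r_zero phi r.

Definition eps9 (rho phi r alpha beta psi : R) : R :=
  (8 + 7 * (phi * psi * r)) * alpha ^+ 2 * rho ^+ 2 * r_zero phi r
    / (phi * psi * r)
  + (2 * beta ^+ 2 + 1) * r_zero phi r.

Definition kappa3 (rho rho2 Lf phi r alpha beta psi : R) : R :=
  let m := Num.min (eps1 rho2 Lf alpha beta / eps2 rho Lf phi r alpha beta psi)
    (Num.min (eps3 rho2 beta / eps4 rho rho2 phi r beta psi)
       (eps5 rho2 Lf alpha beta / eps6 rho2 Lf alpha beta)) in
  let e7 := eps7 phi r psi in
  let e8 := eps8 rho phi r alpha beta in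
  let e9 := eps9 rho phi r alpha beta psi in
  (* r_zero phi r = 0 forces e9 = 0, whence the case distinction *)
  if r_zero phi r == 0 then m
  else Num.min m ((Num.sqrt (e8 ^+ 2 + 4 * e7 * e9) - e8) / (2 * e9)).

End constants.

(* u = O(1), with values in the extended reals *)
Definition bigO_one (R : realType) (u : nat -> \bar R) : Prop :=
  exists M : R, forall T : nat, (`|u T| <= M%:E)%E.

(* Main.v *)
Require Import Defs.
From HB Require Import structures.
From mathcomp Require Import all_boot all_order all_algebra.
From mathcomp Require Import finmap.
From mathcomp Require Import complex ring lra.
From mathcomp Require Import all_classical all_reals all_analysis.
From mathcomp Require Import measurable_realfun.

(* Stack the agents' vectors into n x d matrices and let J be the averaging
   matrix.  Since a - b = L a along the algorithm, the input of the consensus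
   step is L (a + q), and with s = L^+ (v + grad f(xbar) / beta) the centered
   iterate z = x - J x follows, up to perturbations, a linear saddle-point
   dynamics.  The Lyapunov function
     |z|^2 / 2 + (kappa1 + 1) / 2 <s, L s> + <z, s> + n (f(xbar) - fstar)
       + |x - a|^2
   is nonnegative and, by Young's inequalities, decreases pathwise by a multiple
   of |z|^2 + n |grad f(xbar)|^2, up to the terms |a + q - x|^2 and
   |x - a - psi q|^2.  The seed producing q is independent of the past, so in
   expectation these terms are at most r_0 and 1 - phi psi r times
   E |x - a|^2, and the bounds on eta absorb them.  All expectations are
   integrals of nonnegative functions, so no integrability has to be proved. *)

Set Implicit Arguments.
Unset Strict Implicit.
Unset Printing Implicit Defensive.

Import Order.TTheory GRing.Theory Num.Theory.
Import numFieldNormedType.Exports.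

Local Open Scope classical_set_scope.
Local Open Scope ring_scope.

(** * Frobenius inner product and the saddle-point step *)

(** An energy without the cross term <z, s> would dissipate z only, because the coupling of z and s
    through beta is skew. The cross term buys - beta <s, L s> at the price of about beta |z|^2,
    which alpha = kappa1 * beta pays for once kappa1 * rho2 is large. The weight kappa1 + 1 is the
    one for which all products <z, L s> cancel. The dual variable s carries the gradients at the
    average, not those at the agents. Its drift in one step then comes only from the motion of xbar,
    that is, from eta times the mean gradient, and the descent lemma supplies a negative multiple of
    the square of that mean gradient to pay for it. The mismatch between the two kinds of gradients
    is charged to |z|^2. The term |x - a|^2 closes the loop: the update of a contracts it in
    expectation by 1 - phi psi r, and half of this rate is given up to a Young inequality against
    the motion of x. Hence the recurring factor N = 1 + 2 / (phi psi r). *)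

Section dot_product.
Context {R : realType} {m p : nat}.
Implicit Types (X Y Z : 'M[R]_(m, p)) (M : 'M[R]_m).

Definition dot X Y : R := \tr (X^T *m Y).

Lemma dotE X Y : dot X Y = \sum_i \sum_j X i j * Y i j.
Proof.
rewrite /dot /mxtrace exchange_big /=; apply: eq_bigr => j _.
by rewrite mxE; apply: eq_bigr => i _; rewrite mxE.
Qed.

Lemma dotC X Y : dot X Y = dot Y X.
Proof. by rewrite /dot -[LHS]mxtrace_tr trmx_mul trmxK. Qed.

Lemma dotDl X Y Z : dot (X + Y) Z = dot X Z + dot Y Z.
Proof. by rewrite /dot linearD mulmxDl linearD. Qed.

Lemma dotDr X Y Z : dot X (Y + Z) = dot X Y + dot X Z.
Proof. by rewrite /dot mulmxDr linearD. Qed.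

Lemma dotZl a X Y : dot (a *: X) Y = a * dot X Y.
Proof. by rewrite /dot linearZ -scalemxAl linearZ. Qed.

Lemma dotZr a X Y : dot X (a *: Y) = a * dot X Y.
Proof. by rewrite /dot -scalemxAr linearZ. Qed.

Lemma dotNl X Y : dot (- X) Y = - dot X Y.
Proof. by rewrite -scaleN1r dotZl mulN1r. Qed.

Lemma dotNr X Y : dot X (- Y) = - dot X Y.
Proof. by rewrite -scaleN1r dotZr mulN1r. Qed.

Definition dot_lin := (dotDl, dotDr, dotNl, dotNr, dotZl, dotZr).

Lemma dot_ge0 X : 0 <= dot X X.
Proof.
by rewrite dotE; apply: sumr_ge0 => i _; apply: sumr_ge0 => j _; exact: sqr_ge0.
Qed.

Lemma dot_mulmxl M X Y : dot (M *m X) Y = dot X (M^T *m Y).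
Proof. by rewrite /dot trmx_mul mulmxA. Qed.

Lemma dot0l X : dot 0 X = 0.
Proof. by rewrite /dot trmx0 mul0mx mxtrace0. Qed.

End dot_product.

Section saddle_step.
Context {R : realType} {n d : nat}.
Variables (L : 'M[R]_n) (rho rho2 : R).
Hypothesis L_sym : L^T = L.
Hypothesis rho2_gt0 : 0 < rho2.
Hypothesis rho_ge0 : 0 <= rho.
Hypothesis L_le : forall Y : 'M[R]_(n, d),
  dot (L *m Y) (L *m Y) <= rho * dot Y (L *m Y).
Hypothesis L_le2 : forall Y : 'M[R]_(n, d), dot Y (L *m Y) <= rho * dot Y Y.
Hypothesis L_ge0 : forall Y : 'M[R]_(n, d), 0 <= dot Y (L *m Y).

Definition saddle (kappa : R) (z s : 'M[R]_(n, d)) : R :=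
  dot z z / 2 + (kappa + 1) / 2 * dot s (L *m s) + dot z s.

Lemma saddle_ge0 kappa z s : rho2^-1 <= kappa + 1 ->
  rho2 * dot s s <= dot s (L *m s) -> 0 <= saddle kappa z s.
Proof.
move=> hk hs; rewrite /saddle.
have h1 := dot_ge0 (z + s).
have := h1; rewrite !dot_lin (dotC s z) => h2.
have h3 : dot s s <= rho2^-1 * dot s (L *m s).
  by rewrite mulrC ler_pdivlMr // mulrC.
have h4 : rho2^-1 * dot s (L *m s) <= (kappa + 1) * dot s (L *m s).
  by apply: ler_wpM2r.
lra.
Qed.

(** In the application [e] is the centered compression error, [dl] the disagreement between
    gradients at the agents and at the average, and [L *m t] the centered change of the latter in
    one step. The factors 1 / eta in front of |L t|^2 are harmless because |L t|^2 is then of order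
    eta^2. *)
Lemma saddle_step kappa alpha beta eta (z e s dl t : 'M[R]_(n, d)) :
  0 < beta -> 0 < eta -> 1 <= kappa -> alpha = kappa * beta ->
  rho2 * dot z z <= dot z (L *m z) ->
  rho2 * dot s s <= dot s (L *m s) ->
  rho2 * dot t t <= dot t (L *m t) ->
  saddle kappa (z - eta *: (alpha *: (L *m (z + e)) + beta *: (L *m s) + dl))
               (s + (eta * beta) *: (z + e) + beta^-1 *: t)
  <= saddle kappa z s
   - eta * ((alpha / 2 * rho2 - 9 / 8 * beta - 1) * dot z z
            - 3 / 4 * dot dl dl
            - (alpha / 2 * rho + beta * rho + 2 * beta) * dot e e
            + (beta / 2 - rho2^-1) * dot s (L *m s))
   + eta ^+ 2 * ((3 * alpha ^+ 2 * rho ^+ 2 + 2 * beta ^+ 2 + 1)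
                   * (dot z z + dot e e)
                 + 5 / 2 * dot dl dl
                 + (2 * beta ^+ 2 * rho + rho2^-1) * dot s (L *m s))
   + ((kappa + 1) ^+ 2 / (eta * beta ^+ 3 * rho2)
      + 1 / (2 * eta * beta ^+ 2 * rho2 ^+ 2) + 3 / 4
      + 1 / (2 * beta ^+ 2 * rho2 ^+ 2)
      + (kappa + 1) / (2 * beta ^+ 2 * rho2)) * dot (L *m t) (L *m t).
Proof.
move=> beta0 eta0 kappa1 -> hz hs ht.
have [p pE] : exists p, p = z + e by exists (z + e).
rewrite -pE.
have dotLC (X Y : 'M[R]_(n, d)) : dot X (L *m Y) = dot Y (L *m X).
  by rewrite dotC dot_mulmxl L_sym.
(* Exact expansion. The weight [kappa + 1] leaves <s, L p> with first-order coefficient [beta], and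
   together with - beta <z, L s> only beta <s, L e> survives. *)
have -> : saddle kappa
    (z - eta *: ((kappa * beta) *: (L *m p) + beta *: (L *m s) + dl))
    (s + (eta * beta) *: p + beta^-1 *: t) = saddle kappa z s
  + eta * (- kappa * beta * dot z (L *m p) - beta * dot z (L *m s) - dot z dl
     + beta * dot s (L *m p) + beta * dot z p - beta * dot s (L *m s)
     - dot dl s)
  + (kappa + 1) * beta^-1 * dot s (L *m t) + beta^-1 * dot z t
  + eta ^+ 2 / 2 * dot ((kappa * beta) *: (L *m p) + beta *: (L *m s) + dl)
                       ((kappa * beta) *: (L *m p) + beta *: (L *m s) + dl)
  - eta ^+ 2 * beta * (beta * dot s (L *m p) + dot dl p)
  + eta ^+ 2 * beta ^+ 2 * (1 - kappa) / 2 * dot p (L *m p)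
  + eta * dot p (L *m t) - eta * dot s (L *m t) - eta * beta^-1 * dot dl t
  + (kappa + 1) / 2 * beta^-1 ^+ 2 * dot t (L *m t).
  rewrite /saddle !(mulmxDr, mulmxN) -!scalemxAr !dot_lin.
  have b0 : beta != 0 by rewrite gt_eqF.
  rewrite (dotC (L *m p) z) (dotC (L *m s) z) (dotC dl z).
  rewrite (dotC (L *m p) s) (dotC (L *m s) s) (dotC (L *m p) p).
  rewrite (dotC (L *m s) p) (dotLC p s) (dotC (L *m p) t) (dotC (L *m s) t).
  rewrite (dotLC t s) (dotLC t p) (dotC (L *m s) (L *m p)) (dotC dl (L *m s)).
  rewrite (dotC dl (L *m p)).
  by field.

have pz : dot z p = dot z z + dot z e by rewrite pE dotDr.
have LeLp : dot s (L *m p) - dot z (L *m s) = dot s (L *m e).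
  by rewrite pE mulmxDr dotDr (dotLC z); ring.
have zLp : dot z (L *m p) = dot z (L *m z) + dot z (L *m e).
  by rewrite pE mulmxDr dotDr.
(* Young in the seminorm of L spends half of alpha <z, L z>, hence the factor alpha / 2 in front of
   [rho2]. *)
have hzLe : - dot z (L *m e) <= dot z (L *m z) / 2 + rho / 2 * dot e e.
  have := L_ge0 (z + e); rewrite !(mulmxDr, dot_lin) (dotLC e z).
  have := L_le2 e; lra.
have hzdl : - dot z dl <= dot z z / 2 + dot dl dl / 2.
  by have := dot_ge0 (z + dl); rewrite !dot_lin (dotC dl z); lra.
have hsLe : dot s (L *m e) <= dot s (L *m s) / 4 + rho * dot e e.
  have := L_ge0 (s + (-2) *: e).
  rewrite !(mulmxDr, dot_lin) -!scalemxAr !dot_lin (dotLC e s).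
  by have := L_le2 e; lra.
have hze : dot z e <= dot z z / 8 + 2 * dot e e.
  by have := dot_ge0 (z + (-4) *: e); rewrite !dot_lin (dotC e z); lra.
have hs' : dot s s <= rho2^-1 * dot s (L *m s).
  by rewrite mulrC ler_pdivlMr // mulrC.
have hdls : - dot dl s <= dot dl dl / 4 + rho2^-1 * dot s (L *m s).
  have := dot_ge0 (dl + 2 *: s); rewrite !dot_lin (dotC s dl); lra.
have first : - kappa * beta * dot z (L *m p) - beta * dot z (L *m s) - dot z dl
     + beta * dot s (L *m p) + beta * dot z p - beta * dot s (L *m s)
     - dot dl s <=
  - (kappa * beta / 2 * rho2 - 9 / 8 * beta - 1 / 2) * dot z z
  + 3 / 4 * dot dl dl
  + (kappa * beta / 2 * rho + beta * rho + 2 * beta) * dot e e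
  - (beta * (3 / 4) - rho2^-1) * dot s (L *m s).
  have k0 : 0 <= kappa * beta by rewrite mulr_ge0 // ?ltW //; lra.
  have := ler_wpM2l k0 hzLe.
  have := ler_wpM2l k0 hz.
  have := ler_wpM2l (ltW beta0) hsLe.
  have := ler_wpM2l (ltW beta0) hze.
  rewrite zLp pz.
  have -> : dot s (L *m p) = dot s (L *m e) + dot z (L *m s).
    by rewrite -LeLp; ring.
  lra.

have hL2 (Y : 'M[R]_(n, d)) : dot (L *m Y) (L *m Y) <= rho ^+ 2 * dot Y Y.
  apply: (le_trans (L_le Y)); rewrite expr2 -mulrA.
  exact: ler_wpM2l.
have hp : dot p p <= 2 * dot z z + 2 * dot e e.
  have := dot_ge0 (z - e); rewrite pE !dot_lin (dotC e z); lra.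
have hLp : dot (L *m p) (L *m p) <= 2 * rho ^+ 2 * (dot z z + dot e e).
  have := hL2 z; have := hL2 e; have := dot_ge0 (L *m z - L *m e).
  rewrite pE !(mulmxDr, dot_lin) (dotC (L *m e) (L *m z)); lra.
(* Used with [A] = alpha L p, [U] = beta L s, [D] = dl and [X] = beta p, so that the square and the
   mixed second-order terms are bounded together. *)
have hG (A U D X : 'M[R]_(n, d)) :
    dot (A + U + D) (A + U + D) / 2 - dot U X - dot D X <=
    3 / 2 * dot A A + 2 * dot U U + 2 * dot D D + dot X X.
  have := dot_ge0 (A - U); have := dot_ge0 (A - D); have := dot_ge0 (U - D).
  have := dot_ge0 (U + X); have := dot_ge0 (D + X).
  rewrite !dot_lin (dotC U A) (dotC D A) (dotC D U) (dotC X U) (dotC X D); lra.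
have second :
    dot ((kappa * beta) *: (L *m p) + beta *: (L *m s) + dl)
        ((kappa * beta) *: (L *m p) + beta *: (L *m s) + dl) / 2
  - beta * (beta * dot s (L *m p) + dot dl p) <=
  (3 * (kappa * beta) ^+ 2 * rho ^+ 2 + 2 * beta ^+ 2) * (dot z z + dot e e)
  + 2 * dot dl dl + 2 * beta ^+ 2 * rho * dot s (L *m s).
  have := hG ((kappa * beta) *: (L *m p)) (beta *: (L *m s)) dl (beta *: p).
  rewrite [dot (beta *: (L *m s)) (beta *: p)]dotZl.
  rewrite [dot ((kappa * beta) *: (L *m p)) ((kappa * beta) *: _)]dotZl.
  rewrite [dot (beta *: (L *m s)) (beta *: _)]dotZl.
  rewrite [dot (beta *: p) (beta *: _)]dotZl !dotZr.
  rewrite (dotC (L *m s) p) (dotLC p s).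
  have := ler_wpM2l (sqr_ge0 (kappa * beta)) hLp.
  have := ler_wpM2l (sqr_ge0 beta) hp.
  have := ler_wpM2l (sqr_ge0 beta) (L_le s).
  lra.
(* The coefficient is (kappa + 1) / 2 from <s, L s> minus kappa from the cross term; its sign is
   favourable because [1 <= kappa]. *)
have third : beta ^+ 2 * (1 - kappa) / 2 * dot p (L *m p) <= 0.
  have := mulr_ge0 (sqr_ge0 beta) (L_ge0 p) => h.
  have h' : 0 <= (kappa - 1) * (beta ^+ 2 * dot p (L *m p)).
    by rewrite mulr_ge0 // subr_ge0.
  lra.
set q := dot (L *m t) (L *m t).
have htL : dot t (L *m t) <= rho2^-1 * q.
  have := dot_ge0 (t - rho2^-1 *: (L *m t)).
  rewrite !dot_lin (dotC (L *m t) t) -/q.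
  have ht' : dot t t <= rho2^-1 * dot t (L *m t).
    by rewrite mulrC ler_pdivlMr // mulrC.
  move=> h.
  have h2 : rho2^-1 * dot t (L *m t) <= rho2^-1 * (rho2^-1 * q) by lra.
  by rewrite ler_pM2l ?invr_gt0 // in h2.
have htt : dot t t <= rho2^-1 ^+ 2 * q.
  have ht' : dot t t <= rho2^-1 * dot t (L *m t).
    by rewrite mulrC ler_pdivlMr // mulrC.
  apply: (le_trans ht'); rewrite expr2 -mulrA.
  by apply: ler_wpM2l => //; rewrite invr_ge0 ltW.
have ieta : 0 < eta^-1 by rewrite invr_gt0.
have ibeta : 0 < beta^-1 by rewrite invr_gt0.
have k1 : 0 <= kappa + 1 by lra.
(* The Young weight is tuned to cost a quarter of beta: [first] keeps 3 / 4 beta of <s, L s> and the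
   claim asks for beta / 2. The price is a factor 1 / eta on |L t|^2. *)
have hst : (kappa + 1) * beta^-1 * dot s (L *m t) <=
    eta * beta / 4 * dot s (L *m s)
    + (kappa + 1) ^+ 2 * (eta^-1 * beta^-1 ^+ 3 * rho2^-1) * q.
  have := L_ge0 (s - (2 * (kappa + 1) * (eta^-1 * beta^-1 ^+ 2)) *: t).
  rewrite !(mulmxDr, mulmxN) -!scalemxAr !dot_lin (dotLC t s).
  move=> h.
  have eb0 : 0 <= eta * beta / 4 by rewrite mulr_ge0 // mulr_ge0 // ltW.
  have := ler_wpM2l eb0 h; rewrite mulr0 => {}h.
  have c0 : 0 <= (kappa + 1) ^+ 2 * (eta^-1 * beta^-1 ^+ 3).
    by rewrite mulr_ge0 ?sqr_ge0 // mulr_ge0 ?exprn_ge0 // ltW.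
  have h2 := ler_wpM2l c0 htL.
  have E1 : (kappa + 1) * beta^-1 * dot s (L *m t) =
    eta * beta * ((kappa + 1) * (eta^-1 * beta^-1 ^+ 2)) * dot s (L *m t).
    by field; rewrite !gt_eqF.
  have E2 : (kappa + 1) ^+ 2 * (eta^-1 * beta^-1 ^+ 3) =
    eta * beta / 4 * (2 * (kappa + 1) * (eta^-1 * beta^-1 ^+ 2)) ^+ 2.
    by field; rewrite !gt_eqF.
  rewrite E2 in h2; rewrite E1.
  have : (kappa + 1) ^+ 2 * (eta^-1 * beta^-1 ^+ 3 * rho2^-1) * q =
    eta * beta / 4 * (2 * (kappa + 1) * (eta^-1 * beta^-1 ^+ 2)) ^+ 2
      * rho2^-1 * q by rewrite -E2; ring.
  lra.
have hzt : beta^-1 * dot z t <=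
    eta / 2 * dot z z + eta^-1 * beta^-1 ^+ 2 * rho2^-1 ^+ 2 / 2 * q.
  have := dot_ge0 (z - (eta^-1 * beta^-1) *: t).
  rewrite !dot_lin (dotC t z) => h.
  have e20 : 0 <= eta / 2 by rewrite mulr_ge0 // ltW.
  have := ler_wpM2l e20 h; rewrite mulr0 => {}h.
  have c0 : 0 <= eta^-1 * beta^-1 ^+ 2 / 2.
    by rewrite mulr_ge0 // mulr_ge0 ?sqr_ge0 // ltW.
  have h2 := ler_wpM2l c0 htt.
  have E1 : beta^-1 * dot z t = eta * (eta^-1 * beta^-1) * dot z t.
    by field; rewrite !gt_eqF.
  have E2 : eta^-1 * beta^-1 ^+ 2 / 2 = eta / 2 * (eta^-1 * beta^-1) ^+ 2.
    by field; rewrite !gt_eqF.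
  have : eta^-1 * beta^-1 ^+ 2 * rho2^-1 ^+ 2 / 2 * q =
    eta^-1 * beta^-1 ^+ 2 / 2 * (rho2^-1 ^+ 2 * q) by ring.
  move: h2; rewrite E1 E2; lra.
have hpt : eta * dot p (L *m t) <=
    eta ^+ 2 * (dot z z + dot e e) + q / 2.
  have := dot_ge0 (eta *: p - L *m t); rewrite !dot_lin (dotC (L *m t) p) -/q.
  have := ler_wpM2l (sqr_ge0 eta) hp; lra.
have hst2 : - eta * dot s (L *m t) <=
    eta ^+ 2 * rho2^-1 * dot s (L *m s) + q / 4.
  have := dot_ge0 ((2 * eta) *: s + L *m t).
  rewrite !dot_lin (dotC (L *m t) s) -/q.
  have := ler_wpM2l (sqr_ge0 eta) hs'; lra.
have hdlt : - (eta * beta^-1) * dot dl t <=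
    eta ^+ 2 / 2 * dot dl dl + beta^-1 ^+ 2 * rho2^-1 ^+ 2 / 2 * q.
  have := dot_ge0 (eta *: dl + beta^-1 *: t).
  rewrite !dot_lin (dotC t dl).
  have := ler_wpM2l (sqr_ge0 beta^-1) htt; lra.
have htt2 : (kappa + 1) / 2 * beta^-1 ^+ 2 * dot t (L *m t) <=
    (kappa + 1) / 2 * beta^-1 ^+ 2 * rho2^-1 * q.
  rewrite -[leRHS]mulrA; apply: ler_wpM2l => //.
  by rewrite mulr_ge0 ?sqr_ge0 // mulr_ge0.
have := ler_wpM2l (ltW eta0) first.
have := ler_wpM2l (sqr_ge0 eta) second.
have := ler_wpM2l (sqr_ge0 eta) third; rewrite mulr0.
have -> : (kappa + 1) ^+ 2 / (eta * beta ^+ 3 * rho2)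
      + 1 / (2 * eta * beta ^+ 2 * rho2 ^+ 2) + 3 / 4
      + 1 / (2 * beta ^+ 2 * rho2 ^+ 2)
      + (kappa + 1) / (2 * beta ^+ 2 * rho2) =
   (kappa + 1) ^+ 2 * (eta^-1 * beta^-1 ^+ 3 * rho2^-1)
   + eta^-1 * beta^-1 ^+ 2 * rho2^-1 ^+ 2 / 2 + 3 / 4
   + beta^-1 ^+ 2 * rho2^-1 ^+ 2 / 2
   + (kappa + 1) / 2 * beta^-1 ^+ 2 * rho2^-1.
  by field; rewrite !gt_eqF.
rewrite -/q => H3 H2 H1.
clear - hst hzt hpt hst2 hdlt htt2 H1 H2 H3.
lra.
Qed.
End saddle_step.

(** * Spectral bounds for the Laplacian *)

Section spectral.
Context {R : realType}.
Local Open Scope sesquilinear_scope.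
Local Notation toC := (real_complex R).

(** [W i Y] is the squared norm of row i of P Y, where the unitary P diagonalizes M over the complex
    numbers. Only these real weights leave the proof, so spectral inequalities become termwise
    comparisons of sums. The last clause is there because the spectral radius is defined through
    complex eigenvalues. *)
Lemma sym_spectral (n p : nat) (M : 'M[R]_n) : M^T = M ->
  exists (D : 'I_n -> R) (W : 'I_n -> 'M[R]_(n, p) -> R),
  [/\ forall i Y, 0 <= W i Y,
      forall Y, dot Y Y = \sum_i W i Y,
      forall Y, dot Y (M *m Y) = \sum_i D i * W i Y,
      forall i Y, W i (M *m Y) = D i ^+ 2 * W i Y &
      (forall i, eigenvalue M (D i)) /\
      forall z, eigenvalue (map_mx toC M) z -> exists i, z = toC (D i)].
Proof.
move=> Msym; set Mc := map_mx toC M.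
have conjR (a : R) : (toC a)^* = toC a.
  by apply/CrealP; apply/complex_realP; exists a.
have Mreal : Mc \is a mxOver Num.real.
  by apply/mxOverP => i j; rewrite mxE; apply/complex_realP; exists (M i j).
have Msymc : Mc \is symmetricmx.
  apply/is_hermitianmxP; rewrite expr0 scale1r map_mx_id //.
  by apply/matrixP => i j; rewrite !mxE -[in RHS]Msym mxE.
have Mherm := realsym_hermsym Msymc Mreal.
set P := spectralmx Mc.
have /hermitian_normalmx/orthomx_spectralP := Mherm.
rewrite -/P; set sp := spectral_diag Mc => ME.
have Pu : P \is unitarymx := spectral_unitarymx Mc.
have Punit : P \in unitmx := spectral_unit Mc.
have PI : invmx P = P ^t* := invmx_unitary Pu.
have spreal : forall i, exists k, sp 0 i = toC k.
  move=> i; apply/complex_realP.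
  by have /mxOverP := hermitian_spectral_diag_real Mherm; exact.
pose D i := complex.Re (sp 0 i).
have DE i : sp 0 i = toC (D i) by rewrite /D; have [k ->] := spreal i.
pose Cf (Y : 'M[R]_(n, p)) := P *m map_mx toC Y.
pose W i Y := \sum_j (complex.Re (Cf Y i j) ^+ 2 + complex.Im (Cf Y i j) ^+ 2).
have WE i Y : toC (W i Y) = \sum_j (Cf Y i j)^* * Cf Y i j.
  rewrite rmorph_sum; apply: eq_bigr => j _.
  by rewrite /= add_Re2_Im2 normCK mulrC.
have CM Y : Cf (M *m Y) = diag_mx sp *m Cf Y.
  by rewrite /Cf map_mxM -/Mc {1}ME !mulmxA mulmxV // mul1mx.
have Ctr Y : (map_mx toC Y)^T *m invmx P = (Cf Y) ^t*.
  rewrite PI /Cf trmx_mul map_mxM; congr (_ *m _).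
  apply/matrixP => i j; rewrite !mxE.
  exact/esym/conjR.
have CMij i j Y : Cf (M *m Y) i j = toC (D i) * Cf Y i j.
  by rewrite CM mul_diag_mx mxE DE.
have dotW (Y Z : 'M[R]_(n, p)) :
    toC (dot Y Z) = \sum_i \sum_j (Cf Y i j)^* * Cf Z i j.
  transitivity (\tr ((Cf Y) ^t* *m Cf Z)).
    rewrite -Ctr /Cf mulmxA mulmxKV // /dot.
    by rewrite map_trmx -map_mxM trace_map_mx.
  rewrite /mxtrace exchange_big; apply: eq_bigr => j _; rewrite mxE.
  by apply: eq_bigr => i _; rewrite !mxE.
exists D, W; split.
- by move=> i Y; apply: sumr_ge0 => j _; rewrite addr_ge0 ?sqr_ge0.
- move=> Y; apply: (@complexI R); rewrite dotW rmorph_sum.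
  by apply: eq_bigr => i _; exact: esym (WE i Y).
- move=> Y; apply: (@complexI R); rewrite dotW rmorph_sum.
  apply: eq_bigr => i _; rewrite rmorphM /= WE mulr_sumr.
  by apply: eq_bigr => j _; rewrite CMij mulrCA.
- move=> i Y; apply: (@complexI R); rewrite WE rmorphM /= WE mulr_sumr.
  apply: eq_bigr => j _; rewrite CMij rmorphM /= conjR rmorphXn /=.
  by rewrite expr2; ring.
split=> [i|z].
  (* The rows of P are left eigenvectors. *)
  rewrite -(eigenvalue_map toC) -/Mc; apply/eigenvalueP.
  exists (row i P).
    rewrite {1}ME !mulmxA -row_mul mulmxV // -row_mul mul1mx.
    by rewrite row_diag_mx -scalemxAl -rowE DE.
  apply/eqP => /(congr1 (fun v => v *m invmx P)).
  rewrite mul0mx -row_mul mulmxV // row1 => /rowP/(_ i).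
  by rewrite !mxE !eqxx => /eqP; rewrite oner_eq0.
move=> /eigenvalueP[v vM v0].
pose c := v *m invmx P.
have cD : c *m diag_mx sp = z *: c.
  by rewrite /c scalemxAl -vM ME !mulmxA mulmxK.
have /rV0Pn[i ci] : c != 0.
  apply: contra v0 => /eqP c0; apply/eqP.
  by rewrite -[v](mulmxKV Punit) -/c c0 mul0mx.
exists i; rewrite -DE.
move: cD ci; move: c => c /rowP/(_ i); rewrite mul_mx_diag !mxE mulrC.
move=> /eqP + ci.
by rewrite -subr_eq0 -mulrBl mulf_eq0 (negPf ci) orbF subr_eq0 => /eqP.
Qed.

End spectral.

Section laplacian.
Context {R : realType} {n : nat}.
Variable A : 'M[R]_n.
Hypothesis n_ge2 : (2 <= n)%N.
Hypothesis hA : connected_weighted_graph A.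
Local Notation L := (laplacian A).
Local Notation rho := (spectral_radius L).
Local Notation rho2 := (min_pos_eigenvalue L).

Definition avg_mx : 'M[R]_n := const_mx n%:R^-1.
Local Notation J := avg_mx.

Let n_gt0 : (0 < n)%N. Proof. exact: ltnW. Qed.

Let nR_neq0 : n%:R != 0 :> R.
Proof. by rewrite pnatr_eq0 -lt0n. Qed.

Let Asym i j : A i j = A j i.
Proof. by have [AT _ _ _] := hA; rewrite -[in LHS]AT mxE. Qed.

Lemma laplacian_sym : L^T = L.
Proof.
have [AT _ _ _] := hA.
by rewrite /laplacian linearB /= tr_diag_mx AT.
Qed.

Lemma mul_laplacianE p (Y : 'M[R]_(n, p)) i l :
  (L *m Y) i l = \sum_j A i j * (Y i l - Y j l).
Proof.
rewrite /laplacian mulmxBl mul_diag_mx !mxE mulr_suml -sumrB.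
by apply: eq_bigr => j _; rewrite mulrBr.
Qed.

(** Symmetry of [A] allows exchanging i and j; the mean of the two resulting expressions is a sum of
    squares over edges. *)
Lemma dot_laplacian p (Y : 'M[R]_(n, p)) : dot Y (L *m Y) =
  2^-1 * \sum_i \sum_j A i j * \sum_l (Y i l - Y j l) ^+ 2.
Proof.
have E1 : dot Y (L *m Y) =
    \sum_i \sum_j \sum_l A i j * (Y i l * (Y i l - Y j l)).
  rewrite dotE; apply: eq_bigr => i _; rewrite exchange_big /=.
  apply: eq_bigr => l _; rewrite mul_laplacianE mulr_sumr.
  by apply: eq_bigr => j _; rewrite mulrCA.
have E2 : dot Y (L *m Y) =
    \sum_i \sum_j \sum_l A i j * (Y j l * (Y j l - Y i l)).
  rewrite E1 exchange_big; apply: eq_bigr => i _; apply: eq_bigr => j _.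
  by apply: eq_bigr => l _; rewrite Asym.
have : dot Y (L *m Y) + dot Y (L *m Y) =
    \sum_i \sum_j A i j * \sum_l (Y i l - Y j l) ^+ 2.
  rewrite {1}E1 E2 -big_split; apply: eq_bigr => i _.
  rewrite -big_split; apply: eq_bigr => j _; rewrite -big_split mulr_sumr.
  by apply: eq_bigr => l _ /=; ring.
by move=> <-; field.
Qed.

Lemma dot_laplacian_ge0 p (Y : 'M[R]_(n, p)) : 0 <= dot Y (L *m Y).
Proof.
have [_ A0 _ _] := hA.
rewrite dot_laplacian mulr_ge0 ?invr_ge0 // sumr_ge0 // => i _.
rewrite sumr_ge0 // => j _; rewrite mulr_ge0 // sumr_ge0 // => l _.
exact: sqr_ge0.
Qed.

(** A vanishing sum of nonnegative terms makes Y agree across every edge; connectivity propagates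
    this along a path. *)
Lemma dot_laplacian_eq0 p (Y : 'M[R]_(n, p)) : dot Y (L *m Y) = 0 ->
  forall i j l, Y i l = Y j l.
Proof.
have [_ A0 _ Aconn] := hA.
have sq0 i j : 0 <= \sum_l (Y i l - Y j l) ^+ 2.
  by apply: sumr_ge0 => l _; exact: sqr_ge0.
move=> /eqP; rewrite dot_laplacian mulf_eq0 invr_eq0 pnatr_eq0 /=.
rewrite psumr_eq0 => [|i _]; last by apply: sumr_ge0 => j _; exact: mulr_ge0.
move=> /allP Y0.
have edge i j l : 0 < A i j -> Y i l = Y j l.
  move=> Aij; have := Y0 i (mem_index_enum _).
  rewrite psumr_eq0 => [/allP/(_ j (mem_index_enum _))|k _]; last first.
    exact: mulr_ge0.
  rewrite /= mulf_eq0 gt_eqF //= psumr_eq0 => [/allP|k _]; last exact: sqr_ge0.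
  by move=> /(_ l (mem_index_enum _)); rewrite /= sqrf_eq0 subr_eq0 => /eqP.
move=> i j l; have /connectP[s + ->] := Aconn i j.
elim: s i => //= k s IHs i /andP[Aik /IHs <-].
exact: edge.
Qed.

Lemma avg_mxE p (Y : 'M[R]_(n, p)) i l :
  (J *m Y) i l = n%:R^-1 * \sum_j Y j l.
Proof. by rewrite mxE mulr_sumr; apply: eq_bigr => j _; rewrite mxE. Qed.

Lemma avg_mx_idem : J *m J = J.
Proof.
apply/matrixP => i j; rewrite avg_mxE mxE.
under eq_bigr do rewrite mxE.
by rewrite sumr_const card_ord -[X in _ * X]mulr_natl mulKf.
Qed.

Lemma laplacian_avg : L *m J = 0.
Proof.
apply/matrixP => i j; rewrite mul_laplacianE [RHS]mxE big1 // => k _.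
by rewrite !mxE subrr mulr0.
Qed.

Lemma avg_mx_sym : J^T = J.
Proof. by apply/matrixP => i j; rewrite !mxE. Qed.

Lemma avg_laplacian : J *m L = 0.
Proof.
by rewrite -[LHS]trmxK trmx_mul avg_mx_sym laplacian_sym laplacian_avg trmx0.
Qed.

(** A kernel vector y satisfies <y, L y> + |J y|^2 = 0, so it is constant by connectivity and has
    mean zero. *)
Lemma laplacian_avg_unit : L + J \in unitmx.
Proof.
rewrite -row_free_unit -kermx_eq0; apply/rowV0P => v /sub_kermxP vB.
pose y := v^T.
have By : (L + J) *m y = 0.
  rewrite -[LHS]trmxK trmx_mul trmxK linearD /= laplacian_sym avg_mx_sym vB.
  by rewrite trmx0.
have JE : dot y (J *m y) = dot (J *m y) (J *m y).
  by rewrite dot_mulmxl avg_mx_sym mulmxA avg_mx_idem.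
have : dot y (L *m y) + dot (J *m y) (J *m y) = 0.
  by rewrite -JE -dotDr -mulmxDl By dotC dot0l.
move=> /eqP; rewrite paddr_eq0 ?dot_laplacian_ge0 ?dot_ge0 //.
move=> /andP[/eqP/dot_laplacian_eq0 yc].
rewrite dotE psumr_eq0 => [/allP Jy|i _]; last first.
  by apply: sumr_ge0 => j _; exact: sqr_ge0.
apply/rowP => k; have := Jy k (mem_index_enum _).
rewrite /= big_ord1 mulf_eq0 orbb avg_mxE.
rewrite (eq_bigr (fun=> v 0 k)) => [|j _]; last first.
  by rewrite (yc j k) mxE.
by rewrite sumr_const card_ord -[X in _ * X]mulr_natl mulKf // mxE => /eqP.
Qed.

(** The Moore-Penrose inverse of L. As J is the projector onto the constants, where L vanishes, (L +
    J)^-1 - J inverts L on the mean-zero vectors and kills the constants. *)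
Lemma laplacian_pinv : exists Q : 'M[R]_n,
  [/\ Q *m L = 1%:M - J, L *m Q = 1%:M - J, Q *m J = 0 & J *m Q = 0].
Proof.
have Bu := laplacian_avg_unit; set B := L + J in Bu.
have BJ : B *m J = J by rewrite mulmxDl laplacian_avg avg_mx_idem add0r.
have JB : J *m B = J by rewrite mulmxDr avg_laplacian avg_mx_idem add0r.
have VJ : invmx B *m J = J by rewrite -{1}BJ mulKmx.
have JV : J *m invmx B = J by rewrite -{1}JB mulmxK.
have LE : L = B - J by rewrite /B addrK.
exists (invmx B - J); split.
- rewrite mulmxBl avg_laplacian subr0 LE mulmxBr mulVmx // VJ //.
- by rewrite mulmxBr laplacian_avg subr0 LE mulmxBl mulmxV // JV.
- by rewrite mulmxBl VJ avg_mx_idem subrr.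
- by rewrite mulmxBr JV avg_mx_idem subrr.
Qed.

Lemma laplacian_bounds :
  [/\ 0 < rho2, rho2 <= rho,
      forall p (Y : 'M[R]_(n, p)),
        dot (L *m Y) (L *m Y) <= rho * dot Y (L *m Y),
      forall p (Y : 'M[R]_(n, p)), dot Y (L *m Y) <= rho * dot Y Y &
      forall p (Y : 'M[R]_(n, p)), J *m Y = 0 ->
        rho2 * dot Y Y <= dot Y (L *m Y)].
Proof.
have eig_ge0 a : eigenvalue L a -> 0 <= a.
  move=> /eigenvalueP[v vL v0]; pose y := v^T.
  have Ly : L *m y = a *: y.
    by rewrite /y -[LHS]trmxK trmx_mul trmxK laplacian_sym vL linearZ.
  have := dot_laplacian_ge0 y; rewrite Ly dotZr pmulr_lge0 //.
  rewrite lt_def dot_ge0 andbT; apply: contra v0.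
  rewrite dotE psumr_eq0 => [/allP y0|i _]; last first.
    by apply: sumr_ge0 => j _; exact: sqr_ge0.
  apply/eqP/rowP => k; have := y0 k (mem_index_enum _).
  by rewrite /= big_ord1 mulf_eq0 orbb !mxE => /eqP.
have lbP : has_lbound [set a : R | eigenvalue L a /\ 0 < a].
  by exists 0 => a [_ /ltW].
have eig_le p D (W : 'I_n -> 'M[R]_(n, p) -> R) :
    (forall i, eigenvalue L (D i)) ->
    (forall z, eigenvalue (map_mx (real_complex R) L) z ->
       exists i, z = real_complex R (D i)) ->
    forall i : 'I_n, [/\ 0 <= D i, D i <= rho & D i = 0 \/ rho2 <= D i].
  move=> eD eC i; split; first exact: eig_ge0.
    apply: (le_trans (ler_norm _)); apply: ub_le_sup.
      (* [sup] dominates the elements of a set only when the set is bounded above; this sum bounds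
         the moduli of all eigenvalues. *)
      exists (\sum_i `|D i|) => _ [z /eC[j ->]] <-.
      rewrite /= expr0n addr0 sqrtr_sqr (bigD1 j) //= lerDl.
      by apply: sumr_ge0.
    exists (real_complex R (D i)); first by rewrite /= eigenvalue_map.
    by rewrite /= expr0n addr0 sqrtr_sqr.
  have := eig_ge0 _ (eD i); rewrite le_eqVlt => /orP[/eqP <-|Di]; first by left.
  by right; apply: ge_inf.
have gap p (Y : 'M[R]_(n, p)) : J *m Y = 0 -> rho2 * dot Y Y <= dot Y (L *m Y).
  have [D [W [W0 W1 W2 W3 [eD eC]]]] := sym_spectral p laplacian_sym.
  have {}eig_le := eig_le _ D W eD eC.
  have [Q [_ LQ _ _]] := laplacian_pinv.
  (* A mean-zero Y lies in the range of L, where the weight [W i] carries a factor [D i ^+ 2]; the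
     zero eigenvalues drop out without a description of their eigenspace. *)
  move=> JY; have -> : Y = L *m (Q *m Y).
    by rewrite mulmxA LQ mulmxBl mul1mx JY subr0.
  rewrite W1 W2 mulr_sumr; apply: ler_sum => i _; rewrite W3.
  have [D0 _ [->|Dr]] := eig_le i; first by rewrite expr0n !mul0r mulr0.
  by apply: ler_wpM2r => //; rewrite mulr_ge0 ?sqr_ge0.
have [D [W [W0 W1 W2 W3 [eD eC]]]] := sym_spectral 1 laplacian_sym.
have eig_le1 := eig_le _ D W eD eC.
(* Otherwise the quadratic form would vanish at the indicator of one vertex, which is not constant
   since [2 <= n]. *)
have [i0 Di0] : exists i, 0 < D i.
  apply: contrapT => /forallNP D0.
  have D0' i : D i = 0.
    have [+ _ _] := eig_le1 i; rewrite le_eqVlt => /orP[/eqP //|].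
    by move=> /D0.
  pose y : 'M[R]_(n, 1) := \col_i (val i == 0%N)%:R.
  have : dot y (L *m y) = 0 by rewrite W2 big1 // => i _; rewrite D0' mul0r.
  move=> /dot_laplacian_eq0 /(_ (Ordinal n_gt0) (Ordinal n_ge2) 0).
  by rewrite !mxE /= => /eqP; rewrite oner_eq0.
have rho2_gt0 : 0 < rho2.
  (* An infimum of positive numbers may be 0; the least positive [D i] serves as a positive lower
     bound. *)
  have [j Dj jmin] := @Order.TotalTheory.arg_minP _ _ _ i0
    (fun i => 0 < D i) D Di0.
  apply: (lt_le_trans Dj); apply: lb_le_inf; first by exists (D i0).
  move=> a [ea a0]; have [|k ak] := eC (real_complex R a).
    by rewrite eigenvalue_map.
  by move: ak a0 => /complexI -> /jmin.
split => //.
- have [_ h [h0|]] := eig_le1 i0; last by move=> /le_trans; apply.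
  by move: Di0; rewrite h0 ltxx.
- move=> p Y.
  have [D' [W' [W0' W1' W2' W3' [eD' eC']]]] := sym_spectral p laplacian_sym.
  have {}eig_le := eig_le _ D' W' eD' eC'.
  rewrite W1' W2' mulr_sumr; apply: ler_sum => i _; rewrite W3' expr2 -mulrA.
  by have [h1 h2 _] := eig_le i; rewrite ler_wpM2r // mulr_ge0.
- move=> p Y.
  have [D' [W' [W0' W1' W2' W3' [eD' eC']]]] := sym_spectral p laplacian_sym.
  have {}eig_le := eig_le _ D' W' eD' eC'.
  rewrite W1' W2' mulr_sumr; apply: ler_sum => i _.
  by have [h1 h2 _] := eig_le i; rewrite ler_wpM2r.
Qed.

End laplacian.

(** * Smooth functions and coordinatewise measurability *)

Lemma enorm_sqr (R : realType) d (x : 'rV[R]_d) : enorm x ^+ 2 = dot x x.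
Proof.
rewrite /enorm sqr_sqrtr; last by apply: sumr_ge0 => j _; exact: sqr_ge0.
by rewrite dotE big_ord1; apply: eq_bigr => j _; rewrite expr2.
Qed.

Lemma enorm_ge0 (R : realType) d (x : 'rV[R]_d) : 0 <= enorm x.
Proof. exact: sqrtr_ge0. Qed.

Section smooth.
Context {R : realType} {d : nat}.
Implicit Types (f : 'rV[R]_d -> R) (x y v : 'rV[R]_d).

Lemma derive_grad f x v : differentiable f x -> 'D_v f x = dot (grad f x) v.
Proof.
move=> df; rewrite deriveE // {1}(row_sum_delta v) linear_sum /=.
rewrite dotE big_ord1; apply: eq_bigr => j _.
by rewrite linearZ /= -deriveE // mxE mulrC.
Qed.

Lemma is_derive_line f x v (t : R) : differentiable f (x + t *: v) ->
  is_derive t 1 (fun s : R => f (x + s *: v)) ('D_v f (x + t *: v)).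
Proof.
move=> df; have fv : derivable f (x + t *: v) v by exact: diff_derivable.
have E : (fun h : R => h^-1 *: (((fun s : R => f (x + s *: v)) \o shift t)
      (h *: (1 : R)) - f (x + t *: v))) =
    (fun h : R => h^-1 *: ((f \o shift (x + t *: v)) (h *: v)
      - f (x + t *: v))).
  apply/funext => h /=; congr (_ *: (f _ - _)).
  have -> : h *: (1 : R) = h by rewrite /GRing.scale /= mulr1.
  by rewrite scalerDl addrCA.
by split; rewrite /derivable /derive E.
Qed.

Lemma descent f (Lf : R) x v : 0 < Lf -> (forall x, differentiable f x) ->
  (forall x y, dot (grad f x - grad f y) (grad f x - grad f y)
               <= Lf ^+ 2 * dot (x - y) (x - y)) ->
  f (x + v) <= f x + dot (grad f x) v + Lf / 2 * dot v v.
Proof.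
move=> Lf0 df lip; set g := grad f x.
pose h := fun s : R => f (x + s *: v).
(* The defect of the claimed quadratic upper bound along the segment: by the mean value theorem it
   is enough that its derivative is nonpositive inside ]0, 1[. *)
pose phi := fun s : R => h s - s * dot g v - s ^+ 2 * (Lf / 2 * dot v v).
pose dphi := fun s : R =>
  'D_v f (x + s *: v) - dot g v - s * (Lf * dot v v) : R.
have phiD (s : R) : is_derive s 1 phi (dphi s).
  have hD := is_derive_line (df (x + s *: v)).
  have -> : phi = h - (fun s : R => s * dot g v)
                    - (fun s : R => s ^+ 2 * (Lf / 2 * dot v v)) by [].
  apply: is_derive_eq.
  by rewrite /dphi /GRing.scale /=; field.
have [c cI cE] : exists2 c, c \in `]0, 1[%R & phi 1 - phi 0 = dphi c * (1 - 0).
  apply: MVT => //.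
  apply: continuous_subspaceT => s.
  by apply/differentiable_continuous/derivable1_diffP; have [] := phiD s.
move: cI cE; rewrite in_itv /= => /andP[c0 c1].
have -> : phi 1 = f (x + v) - dot g v - Lf / 2 * dot v v.
  by rewrite /phi /h scale1r; ring.
have -> : phi 0 = f x by rewrite /phi /h scale0r addr0; ring.
rewrite subr0 mulr1 => E.
have : dphi c <= 0.
  rewrite /dphi derive_grad //.
  have Lc0 : 0 < Lf * c by rewrite mulr_gt0.
  have := lip (x + c *: v) x.
  have -> : x + c *: v - x = c *: v by rewrite addrC addKr.
  rewrite dotZl dotZr -/g.
  (* This square, together with |w - g| <= Lf c |v|, gives <w - g, v> <= Lf c |v|^2 in place of
     Cauchy-Schwarz. *)
  have := dot_ge0 (grad f (x + c *: v) - g - (Lf * c) *: v).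
  set w := grad f (x + c *: v).
  have -> : dot w v = dot (w - g) v + dot g v by rewrite !dot_lin; ring.
  rewrite [dot (_ - _ - _) _]dotDr !dotNr !dotZr.
  rewrite ![dot (_ - _ - _) _]dotDl !dotNl !dotZl (dotC v (w - g)) => h1 h2.
  have : (Lf * c) * (dot (w - g) v - c * (Lf * dot v v)) <= 0 by lra.
  by rewrite pmulr_rle0 //; lra.
move: E => <-; lra.
Qed.

Lemma euclidean_lipschitz_continuous (phi : 'rV[R]_d -> R) (K : R) : 0 <= K ->
  (forall x y, (phi x - phi y) ^+ 2 <= K * dot (x - y) (x - y)) ->
  continuous phi.
Proof.
move=> K0 lip x; apply/(@cvgrPdist_lt _ _ _ (nbhs x)) => e e0.
(* Balls are those of the sup norm, so entries within [dl] give a squared Euclidean distance of at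
   most d dl^2. The summand 1 yields K d < D <= D^2. *)
pose D := K * d%:R + 1; have D0 : 0 < D by rewrite ltr_wpDl // mulr_ge0.
pose dl := e / D; have dl0 : 0 < dl by rewrite divr_gt0.
near=> y.
have [_ /(_ 0) xy] : ball x dl y by near: y; exact: nbhsx_ballx.
have h1 : dot (x - y) (x - y) <= d%:R * dl ^+ 2.
  rewrite dotE big_ord1 mulr_natl -[d in _ *+ d]card_ord -sumr_const.
  apply: ler_sum => j _; rewrite !mxE -expr2 -real_normK ?num_real //.
  by apply: lerXn2r; rewrite ?nnegrE // ltW // xy.
have h2 : (phi x - phi y) ^+ 2 < e ^+ 2.
  apply: (le_lt_trans (lip x y)).
  apply: (@le_lt_trans _ _ (K * d%:R * dl ^+ 2)).
    by rewrite -mulrA ler_wpM2l.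
  have -> : e = D * dl by rewrite /dl mulrC divfK // gt_eqF.
  have DD : D <= D ^+ 2.
    by rewrite expr2 ler_peMl ?(ltW D0) // /D lerDr mulr_ge0.
  rewrite [(D * dl) ^+ 2]exprMn ltr_pM2r ?exprn_gt0 //; apply: lt_le_trans DD.
  by rewrite /D ltrDl.
have e_ge0 := ltW e0.
rewrite -(ltr_pXn2r (n := 2)) ?nnegrE // -normrX ger0_norm // sqr_ge0.
Unshelve. all: by end_near.
Qed.

End smooth.

Section coord_measurable.
Context {R : realType} {dT : measure_display} {T : measurableType dT}.

(** The source is any measurable space, so the same closure lemmas serve for Omega and for the
    coarser sigma-algebra of the past. *)
Definition coord_measurable m p (X : T -> 'M[R]_(m, p)) : Prop :=
  forall i j, measurable_fun [set: T] (fun w => X w i j).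

Lemma coord_measurableD m p (X Y : T -> 'M[R]_(m, p)) :
  coord_measurable X -> coord_measurable Y ->
  coord_measurable (fun w => X w + Y w).
Proof.
move=> mX mY i j; under eq_fun do rewrite mxE.
exact: measurable_funD.
Qed.

Lemma coord_measurableZ m p (a : R) (X : T -> 'M[R]_(m, p)) :
  coord_measurable X -> coord_measurable (fun w => a *: X w).
Proof.
move=> mX i j; under eq_fun do rewrite mxE.
exact: measurable_funM.
Qed.

Lemma coord_measurableB m p (X Y : T -> 'M[R]_(m, p)) :
  coord_measurable X -> coord_measurable Y ->
  coord_measurable (fun w => X w - Y w).
Proof.
move=> mX mY; apply: coord_measurableD => //.
by under eq_fun do rewrite -scaleN1r; exact: coord_measurableZ.
Qed.

Lemma coord_measurable_cst m p (X : 'M[R]_(m, p)) :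
  coord_measurable (fun=> X).
Proof. by move=> i j; exact: measurable_cst. Qed.

Lemma coord_measurable_sum m p (I : Type) (s : seq I)
  (X : I -> T -> 'M[R]_(m, p)) : (forall i, coord_measurable (X i)) ->
  coord_measurable (fun w => \sum_(i <- s) X i w).
Proof.
move=> mX i j; under eq_fun do rewrite summxE.
by apply: measurable_sum => k; exact: mX.
Qed.

Lemma coord_measurable_mulmx m n p (M : 'M[R]_(m, n)) (X : T -> 'M[R]_(n, p)) :
  coord_measurable X -> coord_measurable (fun w => M *m X w).
Proof.
move=> mX i j; under eq_fun do rewrite mxE.
by apply: measurable_sum => k; apply: measurable_funM.
Qed.

Lemma measurable_dot m p (X Y : T -> 'M[R]_(m, p)) :
  coord_measurable X -> coord_measurable Y ->
  measurable_fun [set: T] (fun w => dot (X w) (Y w)).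
Proof.
move=> mX mY; under eq_fun do rewrite dotE.
apply: measurable_sum => i; apply: measurable_sum => j.
exact: measurable_funM.
Qed.

(* An open set is a countable union of open boxes with rational centers and
   radii 1/(k+1). *)
Lemma measurable_continuous d (phi : 'rV[R]_d -> R) (X : T -> 'rV[R]_d) :
  continuous phi -> coord_measurable X ->
  measurable_fun [set: T] (fun w => phi (X w)).
Proof.
move=> cphi mX.
apply: (measurability _ (RGenOInfty.measurableE R)) => _ [_ [a ->] <-].
rewrite setTI; pose U := phi @^-1` `]a, +oo[%classic.
have oU : open U.
  by move/continuousP: cphi; apply; exact: interval_open.
pose cube (q : 'rV[rat]_d) (k : nat) : set 'rV[R]_d :=
  [set y | forall j, `|ratr (q 0 j) - y 0 j| < k.+1%:R^-1].
have mcube q k : measurable (X @^-1` cube q k).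
  have -> : X @^-1` cube q k = \bigcap_(j in [set: 'I_d])
      (fun w => `|ratr (q 0 j) - X w 0 j|) @^-1` `]-oo, k.+1%:R^-1[%classic.
    apply/seteqP; split=> w /= h j; first by move=> _; rewrite /= in_itv /= h.
    by have := h j I; rewrite /= in_itv.
  apply: fin_bigcap_measurable => // j _; rewrite -[X in measurable X]setTI.
  have mf : measurable_fun [set: T] (fun w => `|ratr (q 0 j) - X w 0 j|).
    by apply: measurableT_comp => //; apply: measurable_funB.
  exact: mf.
have -> : (fun w => phi (X w)) @^-1` `]a, +oo[%classic =
    \bigcup_(qk in [set: 'rV[rat]_d * nat])
      (if `[< cube qk.1 qk.2 `<=` U >] then X @^-1` cube qk.1 qk.2 else set0).
  apply/seteqP; split=> w /=.
    move=> Uw; have /nbhs_ballP[e /= e0 eU] : nbhs (X w) U.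
      by apply: open_nbhs_nbhs; split.
    pose k := Num.truncn (2 / e).
    have ke : 2 / k.+1%:R < e.
      by rewrite ltr_pdivrMr // mulrC -ltr_pdivrMr //; exact: truncnS_gt.
    have /choice[q qP] : forall j, exists q : rat,
        `|ratr q - X w 0 j| < k.+1%:R^-1.
      move=> j; have [|q] := @rat_in_itvoo R (X w 0 j - k.+1%:R^-1)
          (X w 0 j + k.+1%:R^-1).
        by rewrite ltrD2l gtrN.
      by rewrite in_itv /= => hq; exists q; rewrite ltr_distl.
    exists (\row_j q j, k) => //=.
    rewrite ifT; first by move=> j; rewrite mxE.
    apply/asboolP => y ycube; apply: eU; split => // i j; rewrite (ord1 i).
    have := ycube j; rewrite mxE => yq.
    change (`|X w 0 j - y 0 j| < e).
    apply: (le_lt_trans (ler_distD (ratr (q j)) _ _)).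
    apply: lt_trans ke; rewrite [2 / _]mulr_natl mulr2n ltrD //.
    by rewrite distrC.
  move=> [[q k] _] /=; case: ifPn => [/asboolP qU|_ []] /qU //.
apply: countable_bigcupT_measurable => [|[q k]]; first exact: countableP.
by case: ifPn => // _; exact: mcube.
Qed.

End coord_measurable.

(** * Independence of the fresh seeds from the past *)

Section independence.
Context {R : realType} {dO dS dV : measure_display}.
Context {Omega : measurableType dO} {S : measurableType dS}.
Context {V : measurableType dV}.
Variables (P : probability Omega R) (mu : probability S R).
Variables (G : set (set Omega)) (xi : Omega -> S) (Y : Omega -> V).
Hypothesis mxi : measurable_fun [set: Omega] xi.
Hypothesis GI : setI_closed G.
Hypothesis GT : G setT.
Hypothesis Gm : G `<=` measurable.
Hypothesis xiG : forall B E, measurable B -> G E ->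
  P (xi @^-1` B `&` E) = (mu B * P E)%E.
Hypothesis mY : measurable_fun [set: g_sigma_algebraType G] Y.

Let sGm : <<s G >> `<=` measurable.
Proof. by apply: smallest_sub => //; exact: sigma_algebra_measurable. Qed.

(** Both sides are finite measures in E, namely P restricted to the preimage of B and P scaled by
    mu(B); they agree on the pi-system [G], hence on what it generates. *)
Lemma indep_sigma_algebra B E : measurable B -> <<s G >> E ->
  P (xi @^-1` B `&` E) = (mu B * P E)%E.
Proof.
move=> mB GE.
have mxB : measurable (xi @^-1` B).
  by rewrite -[X in measurable X]setTI; exact: mxi.
have mu0 : (0 <= fine (mu B))%R by rewrite fine_ge0.
pose c : {nonneg R} := NngNum mu0.
have -> : (mu B * P E = mscale c P E)%E.
  by rewrite /mscale /= fineK // fin_num_measure.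
rewrite setIC -[LHS]/(mrestr P mxB E).
apply: (g_sigma_algebra_measure_unique G Gm (fun=> setT) (fun=> GT) _
  (mrestr P mxB) (mscale c P)) => //.
- by rewrite bigcup_const.
- move=> A GA.
  transitivity ((fine (mu B))%:E * P A)%E => //.
  by rewrite fineK ?fin_num_measure // -xiG // setIC.
- by move=> _; rewrite /= /mrestr setTI ltey_eq fin_num_measure.
Qed.

Let mYO : measurable_fun [set: Omega] Y.
Proof. by move=> _ B mB; apply: sGm; exact: mY. Qed.

(* The joint law of xi and Y is the product of mu and the law of Y. *)
Lemma integral_indep (h : S * V -> \bar R) :
  measurable_fun [set: S * V] h -> (forall p, 0 <= h p)%E ->
  (\int[P]_w h (xi w, Y w) = \int[P]_w \int[mu]_s h (s, Y w))%E.
Proof.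
move=> mh h0.
have mZ : measurable_fun [set: Omega] (fun w => (xi w, Y w)).
  exact: measurable_fun_pair.
pose Ym : {mfun Omega >-> V} := HB.pack Y (isMeasurableFun.Build _ _ _ _ _ mYO).
pose Zm : {mfun Omega >-> (S * V)%type} :=
  HB.pack (fun w => (xi w, Y w)) (isMeasurableFun.Build _ _ _ _ _ mZ).
transitivity (\int[distribution P Zm]_p h p)%E.
  by rewrite ge0_integral_distribution.
transitivity (\int[mu \x distribution P Ym]_p h p)%E.
  apply: eq_measure_integral => A mA _; apply/esym.
  apply: product_measure_unique => // B C mB mC.
  rewrite /distribution /pushforward /=.
  rewrite -(indep_sigma_algebra mB) //.
  by have := mY measurableT mC; rewrite setTI.
rewrite fubini_tonelli2 // ge0_integral_distribution //.
  exact: measurable_fun_fubini_tonelli_G.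
by move=> y; apply: integral_ge0.
Qed.

End independence.

Section past.
Context {R : realType} {n : nat} {dO dS : measure_display}.
Context {Omega : measurableType dO} {S : measurableType dS}.
Variables (P : probability Omega R) (mu : probability S R).
Variable xi : 'I_n -> nat -> Omega -> S.
Hypothesis hxi : fresh_seeds P mu xi.

(* A pi-system generating the sigma-algebra of the seeds used before round k. *)
Definition past (k : nat) : set (set Omega) :=
  [set E | exists2 B : 'I_n * nat -> set S, forall jl, measurable (B jl) &
    E = \bigcap_(jl in [set jl | (jl.2 < k)%N]) (xi jl.1 jl.2 @^-1` B jl)].

Lemma past_setI_closed k : setI_closed (past k).
Proof.
move=> _ _ [B mB ->] [B' mB' ->]; exists (fun jl => B jl `&` B' jl).
  by move=> jl; exact: measurableI.
by rewrite -bigcapI; apply: eq_bigcapr => jl _; rewrite preimage_setI.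
Qed.

Lemma past_setT k : past k setT.
Proof.
exists (fun=> setT) => //; apply/esym/seteqP; split=> // w _ jl _ //.
Qed.

Lemma measurable_seed i k B : measurable B -> measurable (xi i k @^-1` B).
Proof.
have [mxi _ _] := hxi.
by move=> mB; rewrite -[X in measurable X]setTI; exact: mxi.
Qed.

Let past_finite k : finite_set [set jl : 'I_n * nat | (jl.2 < k)%N].
Proof.
apply: (@sub_finite_set _ _ ([set: 'I_n] `*` [set l | (l < k)%N])).
  by move=> [i l].
by apply: finite_setX => //; exact: finite_II.
Qed.

Lemma past_measurable k : past k `<=` measurable.
Proof.
move=> _ [B mB ->]; apply: fin_bigcap_measurable; first exact: past_finite.
by move=> [i l] _; exact: measurable_seed.
Qed.

Lemma past_subset k l : (k <= l)%N -> past k `<=` past l.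
Proof.
move=> kl _ [B mB ->].
exists (fun jl => if (jl.2 < k)%N then B jl else setT) => [jl|].
  by case: ifP.
apply/seteqP; split=> w h jl jlk.
  by case: ifPn => // jlk'; exact: h.
by have := h jl (leq_trans jlk kl); rewrite /= jlk.
Qed.

Lemma past_seed i k l : (k < l)%N ->
  measurable_fun [set: g_sigma_algebraType (past l)] (xi i k).
Proof.
move=> kl _ B mB; rewrite setTI; apply: sub_sigma_algebra.
exists (fun jl => if jl == (i, k) then B else setT) => [jl|].
  by case: ifP.
apply/seteqP; split=> [w wB jl _|w /(_ (i, k) kl)].
  by case: ifPn => // /eqP ->.
by rewrite /= eqxx.
Qed.

(** The past involves finitely many seeds, all of rounds strictly below k, so (i, k) is a new index;
    joint independence is applied with and without it. *)
Lemma seed_indep_past i k B E : measurable B -> past k E ->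
  P (xi i k @^-1` B `&` E) = (mu B * P E)%E.
Proof.
have [_ law indep] := hxi => mB [B' mB' ->].
pose J := fset_set [set jl : 'I_n * nat | (jl.2 < k)%N].
have JE : [set` J] = [set jl : 'I_n * nat | (jl.2 < k)%N].
  by rewrite /J fset_setK.
have JP jl : (jl \in J) = (jl.2 < k)%N.
  by rewrite /J in_fset_set //; apply/asboolP/idP.
have ikJ : (i, k) \notin J by rewrite JP /= ltnn.
pose B2 jl := if jl == (i, k) then B else B' jl.
have mB2 jl : measurable (B2 jl) by rewrite /B2; case: ifP.
have EJ jl : jl \in J -> B2 jl = B' jl.
  by move=> jlJ; rewrite /B2 ifN //; apply: contraNneq ikJ => <-.
have B2ik : B2 (i, k) = B by rewrite /B2 eqxx.
have := indep ((i, k) |` J)%fset B2 mB2.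
rewrite big_fsetU1 //= B2ik law //.
have -> : (\prod_(jl <- J) P (xi jl.1 jl.2 @^-1` B2 jl) =
    P (\bigcap_(jl in [set jl | (jl.2 < k)%N]) (xi jl.1 jl.2 @^-1` B' jl)))%E.
  rewrite -JE indep //; apply: eq_big_seq => jl jlJ.
  by rewrite EJ.
move=> <-; congr (P _); apply/seteqP; split=> w.
  move=> [wB wB'] jl /=; rewrite in_fset1U => /orP[/eqP ->|jlJ].
    by rewrite /B2 eqxx.
  by rewrite EJ //; apply: wB'; rewrite /= -JP.
move=> h; split.
  by have := h (i, k); rewrite /B2 eqxx; apply; rewrite /= in_fset1U eqxx.
move=> jl /= jlk; rewrite -EJ ?JP //; apply: h.
by rewrite /= in_fset1U JP jlk orbT.
Qed.

End past.

(** * The compressor inequality conditionally on the past *)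

Section compression.
Context {R : realType} {n d : nat} {dO dS : measure_display}.
Context {Omega : measurableType dO} {S : measurableType dS}.
Variables (P : probability Omega R) (mu : probability S R).
Variable xi : 'I_n -> nat -> Omega -> S.
Hypothesis hxi : fresh_seeds P mu xi.
Variables (C : S -> 'rV[R]_d -> 'rV[R]_d) (phi r : R).
Hypothesis hC : compressor mu C phi r.
Hypothesis phi_le1 : phi <= 1.

Let tup (x : 'rV[R]_d) : d.-tuple R := [tuple x 0 j | j < d].

Let row_tup x : \row_l tnth (tup x) l = x.
Proof. by apply/rowP => j; rewrite mxE tnth_mktuple. Qed.

Lemma measurable_tup dT (T : measurableType dT) (x : T -> 'rV[R]_d) :
  coord_measurable x -> measurable_fun [set: T] (fun w => tup (x w)).
Proof.
move=> mx; apply/measurable_fun_tnthP => j.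
rewrite (_ : _ \o _ = fun w => x w 0 j) //.
by apply/funext => w /=; rewrite tnth_mktuple.
Qed.

Lemma measurable_compressor dT (T : measurableType dT) (s : T -> S)
    (x : T -> 'rV[R]_d) :
  measurable_fun [set: T] s -> coord_measurable x ->
  coord_measurable (fun w => C (s w) (x w)).
Proof.
move=> ms mx i j; rewrite (ord1 i).
have [mC _] := hC.
have -> : (fun w => C (s w) (x w) 0 j) =
    (fun p : S * d.-tuple R => C p.1 (\row_l tnth p.2 l) 0 j) \o
    (fun w => (s w, tup (x w))).
  by apply/funext => w /=; rewrite row_tup.
apply: measurableT_comp => //.
by apply: measurable_fun_pair => //; exact: measurable_tup.
Qed.

(** Since x depends on earlier seeds only, [integral_indep] lets the seed of round k be integrated
    first with x frozen. The coefficients are parameters because the estimate serves both for C(y) -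
    y and for y - psi C(y), with y = x - a. *)
Lemma integral_compressor i k (x : Omega -> 'rV[R]_d) (a b A B : R) :
  @coord_measurable R _ (g_sigma_algebraType (past xi k)) _ _ x ->
  0 <= A -> 0 <= B ->
  (forall c y : 'rV[R]_d, dot (a *: c + b *: y) (a *: c + b *: y) <=
     A * dot (r^-1 *: c - y) (r^-1 *: c - y) + B * dot y y) ->
  (\int[P]_w (dot (a *: C (xi i k w) (x w) + b *: x w)
                  (a *: C (xi i k w) (x w) + b *: x w))%:E
   <= (A * (1 - phi) + B)%:E * \int[P]_w (dot (x w) (x w))%:E)%E.
Proof.
move=> mx A0 B0 hAB.
have [mxi _ _] := hxi.
have mxO : coord_measurable x.
  have sub : <<s past xi k >> `<=` measurable.
    apply: smallest_sub; first exact: sigma_algebra_measurable.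
    exact: (past_measurable hxi).
  by move=> i0 j0 _ D mD; apply: sub; exact: mx.
pose g (s : S) (y : 'rV[R]_d) :=
  dot (a *: C s y + b *: y) (a *: C s y + b *: y).
pose h (p : S * d.-tuple R) : \bar R := (g p.1 (\row_l tnth p.2 l))%:E.
have mrow dT (T : measurableType dT) (y : T -> d.-tuple R) :
    measurable_fun [set: T] y ->
    coord_measurable (fun w => \row_l tnth (y w) l).
  move=> my i0 j; under eq_fun do rewrite mxE.
  exact: (measurableT_comp (measurable_tnth j)).
have mg dT (T : measurableType dT) (s : T -> S) (y : T -> 'rV[R]_d) :
    measurable_fun [set: T] s -> coord_measurable y ->
    measurable_fun [set: T] (fun w => g (s w) (y w)).
  move=> ms my; apply: measurable_dot; apply: coord_measurableD;
    apply: coord_measurableZ => //; exact: measurable_compressor.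
have mh : measurable_fun [set: S * d.-tuple R] h.
  by apply/measurable_EFinP; apply: mg => //; exact: mrow.
have h0 p : (0 <= h p)%E by rewrite lee_fin dot_ge0.
have E := integral_indep (mxi i k) (@past_setI_closed _ _ _ _ _ xi k)
  (past_setT xi k) (past_measurable hxi (k := k))
  (fun B E mB => seed_indep_past hxi i (E := E) mB) (measurable_tup mx) mh h0.
under eq_integral do rewrite -/(g (xi i k _) (x _)).
have -> : (\int[P]_w (g (xi i k w) (x w))%:E =
           \int[P]_w h (xi i k w, tup (x w)))%E.
  by apply: eq_integral => w _; rewrite /h /= row_tup.
have AB0 : 0 <= A * (1 - phi) + B.
  by rewrite addr_ge0 // mulr_ge0 // subr_ge0.
rewrite E -ge0_integralZl_EFin //; last 2 first.
- by move=> w _; rewrite lee_fin dot_ge0.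
- by apply/measurable_EFinP/measurable_dot.
apply: ge0_le_integral => //.
- by move=> w _; apply: integral_ge0.
- apply: (@measurableT_comp _ _ _ _ _ _ (fubini_G mu h) _ (tup \o x)).
    exact: measurable_fun_fubini_tonelli_G.
  exact: measurable_tup.
- by apply: measurable_funeM; apply/measurable_EFinP/measurable_dot.
move=> w _; set y := x w.
have hy s : h (s, tup y) = (g s y)%:E by rewrite /h /= row_tup.
under eq_integral do rewrite hy.
have mCy : coord_measurable (fun s : S => C s y).
  by apply: measurable_compressor => //; exact: coord_measurable_cst.
have mD : measurable_fun [set: S]
    (fun s => dot (r^-1 *: C s y - y) (r^-1 *: C s y - y)).
  by apply: measurable_dot; apply: coord_measurableB;
    [exact: coord_measurableZ|exact: coord_measurable_cst
    |exact: coord_measurableZ|exact: coord_measurable_cst].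
apply: (@le_trans _ _ (\int[mu]_s
    ((A * dot (r^-1 *: C s y - y) (r^-1 *: C s y - y))%:E
     + (B * dot y y)%:E))%E).
  apply: ge0_le_integral => //.
  - by move=> s _; rewrite lee_fin dot_ge0.
  - apply/measurable_EFinP; apply: mg => //; exact: coord_measurable_cst.
  - apply: emeasurable_funD => //.
    by apply/measurable_EFinP; exact: measurable_funM.
  - by move=> s _; rewrite -EFinD lee_fin hAB.
rewrite ge0_integralD //; last 3 first.
- by move=> s _; rewrite lee_fin mulr_ge0 // dot_ge0.
- by apply/measurable_EFinP; exact: measurable_funM.
- by move=> s _; rewrite lee_fin mulr_ge0 // dot_ge0.
have -> : (\int[mu]_s (B * dot y y)%:E = (B * dot y y)%:E)%E.
  by rewrite integral_cst //= (@probability_setT _ _ _ mu) mule1.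
under eq_integral do rewrite EFinM.
rewrite ge0_integralZl_EFin //; last 2 first.
- by move=> s _; rewrite lee_fin dot_ge0.
- exact/measurable_EFinP.
rewrite -[leRHS]EFinM mulrDl EFinD leeD2r // -mulrA EFinM lee_pmul //.
  by apply: integral_ge0 => s _; rewrite lee_fin dot_ge0.
have [_ /(_ y)] := hC; rewrite unlock enorm_sqr; apply: le_trans.
by under eq_integral do rewrite -enorm_sqr.
Qed.
End compression.

(** * Margins left by the bounds on the parameters *)

Section parameters.
Context {R : realType}.
Variables (rho rho2 Lf phi r kappa1 kappa4 alpha beta eta psi : R).
Hypotheses (rho2_gt0 : 0 < rho2) (rho2_le : rho2 <= rho) (Lf_gt0 : 0 < Lf).
Hypotheses (hphi : 0 < phi <= 1) (hr : 0 < r) (hpsi : 0 < psi <= r^-1).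
Hypothesis hkappa4 : 0 < kappa4.
Hypothesis hkappa1 : kappa1_bound rho2 kappa4 <= kappa1.
Hypothesis halpha : alpha = kappa1 * beta.
Hypothesis hbeta : kappa2 rho2 Lf kappa1 kappa4 < beta.
Hypothesis heta : 0 < eta < kappa3 rho rho2 Lf phi r alpha beta psi.

Local Notation c := (phi * psi * r).
Local Notation N := (1 + 2 / c).

Let phi_ge0 : 0 <= phi. Proof. by case/andP: hphi => /ltW. Qed.
Let psi_ge0 : 0 <= psi. Proof. by case/andP: hpsi => /ltW. Qed.
Let r_ge0 : 0 <= r. Proof. exact: ltW. Qed.
Let Lf_ge0 : 0 <= Lf. Proof. exact: ltW. Qed.
Let rho2_ge0 : 0 <= rho2. Proof. exact: ltW. Qed.

Lemma rate_bounds : 0 < c <= 1.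
Proof.
case/andP: hphi => phi0 phi1; case/andP: hpsi => psi0 psi1.
have psir : psi * r <= 1 by rewrite -ler_pdivlMr // div1r.
rewrite !mulr_gt0 //= -mulrA mulr_ile1 // ?mulr_ge0 //; exact: ltW.
Qed.

Let phi_neq0 : phi != 0.
Proof. by case/andP: hphi => /gt_eqF ->. Qed.
Let psi_neq0 : psi != 0.
Proof. by case/andP: hpsi => /gt_eqF ->. Qed.
Let r_neq0 : r != 0. Proof. by rewrite gt_eqF. Qed.

Let c_ge0 : 0 <= c. Proof. by case/andP: rate_bounds => /ltW. Qed.

Lemma kappa1_ge : [/\ 1 <= kappa1 & 9 / 2 / rho2 <= kappa1].
Proof.
move: hkappa1; rewrite /kappa1_bound ge_max => /andP[h ->]; split => //.
apply: le_trans h; rewrite invfM mulrA ler_pM2r ?invr_gt0 //.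
by rewrite ler_pM2r ?invr_gt0 // lerDl ltW.
Qed.

Lemma beta_gt : 6 / rho2 < beta.
Proof.
by move: hbeta; rewrite /kappa2 /kappa5 !gt_max -!andbA => /and3P[].
Qed.

Lemma beta_gt0 : 0 < beta.
Proof. by apply: le_lt_trans beta_gt; rewrite divr_ge0 //. Qed.

Let beta_ge0 : 0 <= beta. Proof. exact: ltW beta_gt0. Qed.

Lemma alpha_gt0 : 0 < alpha.
Proof.
have [k1 _] := kappa1_ge.
by rewrite halpha mulr_gt0 ?beta_gt0 //; apply: lt_le_trans k1.
Qed.

Let alpha_ge0 : 0 <= alpha. Proof. exact: ltW alpha_gt0. Qed.

Lemma N_ge3 : 3 <= N.
Proof.
have /andP[c0 c1] := rate_bounds.
have : 2 <= 2 / c by rewrite ler_pdivlMr // ler_piMr.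
lra.
Qed.

Let eta_gt0 : 0 < eta. Proof. by case/andP: heta. Qed.
Let N_ge3' := N_ge3.
Let rho_gt0 : 0 < rho. Proof. exact: lt_le_trans rho2_le. Qed.

Let rho_ge0 : 0 <= rho. Proof. exact: ltW. Qed.
Let eta_ge0 : 0 <= eta. Proof. exact: ltW. Qed.

Let NE x : x * (2 + c) / c = x * N.
Proof.
have /andP[c0 c1] := rate_bounds.
rewrite -mulrA; congr (_ * _); rewrite mulrDl divff ?gt_eqF //; exact: addrC.
Qed.

(** The first three quotients in [kappa3] with denominators cleared; the last term of [kappa3] is
    used in [compression_margin]. *)
Lemma eps_bounds :
  [/\ eta * eps2 rho Lf phi r alpha beta psi < eps1 rho2 Lf alpha beta,
      eta * eps4 rho rho2 phi r beta psi < eps3 rho2 beta &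
      eta * eps6 rho2 Lf alpha beta < eps5 rho2 Lf alpha beta].
Proof.
have /andP[c0 c1] := rate_bounds; have [k1 _] := kappa1_ge.
have b0 := beta_gt0.
have a0 := alpha_gt0.
have e2 : 0 < eps2 rho Lf phi r alpha beta psi.
  have N0 : 0 <= 4 * (2 + c) / c by rewrite divr_ge0 // mulr_ge0 // addr_ge0.
  rewrite /eps2.
  have := mulr_ge0 N0
    (addr_ge0 (mulr_ge0 (sqr_ge0 alpha) (sqr_ge0 rho)) (sqr_ge0 Lf)).
  have := sqr_ge0 Lf; have := sqr_ge0 beta.
  have := mulr_ge0 (sqr_ge0 alpha) (sqr_ge0 rho).
  lra.
have e4 : 0 < eps4 rho rho2 phi r beta psi.
  rewrite /eps4 ltr_pwDr ?invr_gt0 // addr_ge0 //.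
    by rewrite mulr_ge0 ?mulr_ge0 ?sqr_ge0 //.
  by rewrite divr_ge0 // ?mulr_ge0 // ?sqr_ge0 // ?addr_ge0.
have e6 : 0 < eps6 rho2 Lf alpha beta.
  rewrite /eps6 ltr_pwDr ?divr_gt0 // !addr_ge0 //.
  - by rewrite divr_ge0 ?mulr_ge0 ?sqr_ge0 ?addr_ge0 ?exprn_ge0 //.
  - by rewrite divr_ge0 ?mulr_ge0 ?sqr_ge0.
  - by rewrite divr_ge0 ?mulr_ge0 ?sqr_ge0.
case/andP: heta => _; rewrite /kappa3.
rewrite -!ltr_pdivlMr //.
case: ifP => _; rewrite !lt_min => h.
  by case/and3P: h.
by case/andP: h => /and3P[].
Qed.

Let NN : 4 * (2 + c) / c = 4 * N. Proof. exact: NE. Qed.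

(* The bound eta < eps1 / eps2 alone controls eta * N. *)
Let eta_N : 8 * (eta * N) * (alpha * rho) < 1.
Proof.
have [+ _ _] := eps_bounds; rewrite /eps2 /eps1 NN.
have [k1 _] := kappa1_ge; have b0 := beta_gt0.
have a0 := alpha_gt0.
have L0 := sqr_ge0 Lf; have b20 := sqr_ge0 beta.
have ar0 := mulr_ge0 (sqr_ge0 alpha) (sqr_ge0 rho).
have N0 : 0 <= 4 * N by have := N_ge3'; lra.
move=> h.
have h1 : eta * (4 * N * (alpha ^+ 2 * rho ^+ 2)) <=
  eta * (3 * Lf ^+ 2 + 4 * N * (alpha ^+ 2 * rho ^+ 2 + Lf ^+ 2)
    + 2 * beta ^+ 2 + 1 + 3 * alpha ^+ 2 * rho ^+ 2).
  rewrite ler_pM2l // mulrDr.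
  have := mulr_ge0 N0 L0; lra.
have h2 : alpha * rho2 <= alpha * rho by rewrite ler_pM2l.
have h3 : alpha * rho * (8 * (eta * N) * (alpha * rho)) < alpha * rho * 1.
  have -> : alpha * rho * (8 * (eta * N) * (alpha * rho)) =
    2 * (eta * (4 * N * (alpha ^+ 2 * rho ^+ 2))) by ring.
  lra.
by rewrite ltr_pM2l ?mulr_gt0 in h3.
Qed.

(** This is eta < eps1 / eps2 with slack: [eps1] subtracts twice the multiple of beta needed here,
    and [eps2] has 3 Lf^2 in place of 5 / 2 Lf^2. Strictness matters because the final bound on the
    consensus error divides by this margin. *)
Lemma consensus_margin :
  0 < alpha / 2 * rho2 - 9 / 8 * beta - 1 - 5 / 4 * Lf ^+ 2
      - eta * (3 * alpha ^+ 2 * rho ^+ 2 + 2 * beta ^+ 2 + 1 + 5 / 2 * Lf ^+ 2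
               + N * (4 * (alpha ^+ 2 * rho ^+ 2 + Lf ^+ 2))).
Proof.
have [+ _ _] := eps_bounds; rewrite /eps2 /eps1 NN.
have := beta_gt0; have := mulr_ge0 (ltW eta_gt0) (sqr_ge0 Lf).
lra.
Qed.

(* Here rho stands where eps4 has rho ^+ 2, so eta < eps3 / eps4 is not enough
   when rho < 1; then kappa1 >= 9 / 2 / rho2 makes up for the difference. *)
Lemma dual_margin :
  0 <= beta / 2 - rho2^-1
       - eta * (2 * beta ^+ 2 * rho + rho2^-1 + N * (4 * beta ^+ 2 * rho)).
Proof.
have [_ + _] := eps_bounds; rewrite /eps4 /eps3.
have -> : 4 * (2 + c) * beta ^+ 2 * rho ^+ 2 / c = 4 * N * beta ^+ 2 * rho ^+ 2.
  by field; rewrite phi_neq0 psi_neq0 r_neq0.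
have b0 := beta_gt0; have i0 : 0 < rho2^-1 by rewrite invr_gt0.
have [rho1|rho1] := leP 1 rho.
  move=> h.
  have rr : rho <= rho ^+ 2 by rewrite expr2 ler_peMl //.
  have N0 : 0 <= eta * (4 * N * beta ^+ 2).
    rewrite mulr_ge0 ?mulr_ge0 ?sqr_ge0 //.
    by have := N_ge3'; have := ltW eta_gt0; lra.
  have := ler_wpM2l N0 rr; lra.
(* Since 6 / rho2 < beta, the room beta / 2 - 1 / rho2 exceeds beta / 3. On the other side, [eta_N]
   and alpha rho >= 9 / 2 beta give M beta^2 rho <= beta / 36 and M / rho2 <= 1 / 216. *)
move=> _; have [_ k1] := kappa1_ge.
set M := eta * N.
have M0 : 0 < M by rewrite mulr_gt0 //; have := N_ge3'; lra.
have eM : 3 * eta <= M.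
  by rewrite /M mulrC ler_pM2l //; exact: N_ge3'.
have i1 : 1 < rho2^-1 by rewrite invf_gt1 //; apply: le_lt_trans rho1.
have br2 : 6 * rho2^-1 < beta := beta_gt.
have k45 : 9 / 2 <= kappa1 by lra.
have ar : 9 / 2 * beta <= alpha * rho.
  have -> : alpha * rho = beta * (kappa1 * rho) by rewrite halpha; ring.
  rewrite mulrC ler_pM2l //.
  have : kappa1 * rho2 <= kappa1 * rho by rewrite ler_pM2l //; lra.
  by move: k1; rewrite ler_pdivrMr //; lra.
have hM := eta_N; rewrite -/M in hM.
have h1 : M * (36 * beta) < 1.
  have := ler_wpM2l (ltW M0) ar; lra.
have h2 : M * beta ^+ 2 * rho * 36 <= beta.
  have : 8 * M * (kappa1 * beta * rho) * beta <= 1 * beta.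
    by rewrite ler_pM2r // ltW // -halpha.
  have : 0 <= (kappa1 - 9 / 2) * (M * beta ^+ 2 * rho).
    rewrite mulr_ge0 ?subr_ge0 //.
    exact: mulr_ge0 (mulr_ge0 (ltW M0) (sqr_ge0 beta)) rho_ge0.
  lra.
have h3 : M * rho2^-1 * 216 <= 1.
  have := ler_wpM2l (ltW M0) (ltW br2); lra.
have h4 : 3 * eta * beta ^+ 2 * rho <= M * beta ^+ 2 * rho.
  by have := ler_wpM2r (mulr_ge0 (sqr_ge0 beta) rho_ge0) eM; rewrite !mulrA.
have h5 : 3 * eta * rho2^-1 <= M * rho2^-1 by rewrite ler_pM2r.
have -> : eta * (2 * beta ^+ 2 * rho + rho2^-1 + N * (4 * beta ^+ 2 * rho)) =
  2 * (eta * beta ^+ 2 * rho) + eta * rho2^-1 + 4 * (M * beta ^+ 2 * rho).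
  by rewrite /M; ring.
lra.
Qed.

(* eps6 does not account for eta ^+ 2 * N, the contribution of the average of
   x_(k+1) - x_k; it fits between the 1 / 8 of eps5 and the available 1 / 2. *)
Lemma gradient_margin :
  ((kappa1 + 1) ^+ 2 / (eta * beta ^+ 3 * rho2)
   + 1 / (2 * eta * beta ^+ 2 * rho2 ^+ 2) + 3 / 4
   + 1 / (2 * beta ^+ 2 * rho2 ^+ 2)
   + (kappa1 + 1) / (2 * beta ^+ 2 * rho2)) * (eta ^+ 2 * Lf ^+ 2)
  + eta ^+ 2 * (Lf / 2) + eta ^+ 2 * N <= eta / 2.
Proof.
have [_ _ h] := eps_bounds; have b0 := beta_gt0; have [k1 _] := kappa1_ge.
(* From 6 < beta rho2 follows 6 <= alpha rho, and [eta_N] turns this into 1 / 48; then 1 / 8 + 1 /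
   48 is below 1 / 2. *)
have M1 : eta * N <= 1 / 48.
  have br2 : 6 <= alpha * rho.
    have h1 : 6 < beta * rho2 by rewrite -ltr_pdivrMr //; exact: beta_gt.
    have h2 : beta * rho2 <= beta * rho by rewrite ler_pM2l.
    have h3 : 0 <= (kappa1 - 1) * (beta * rho).
      by rewrite mulr_ge0 ?subr_ge0 // mulr_ge0 //.
    rewrite halpha; lra.
  have M0 : 0 <= 8 * (eta * N).
    by rewrite !mulr_ge0 // ?(ltW eta_gt0) //; have := N_ge3'; lra.
  have := ler_wpM2l M0 br2; have := eta_N; lra.
have -> : ((kappa1 + 1) ^+ 2 / (eta * beta ^+ 3 * rho2)
   + 1 / (2 * eta * beta ^+ 2 * rho2 ^+ 2) + 3 / 4
   + 1 / (2 * beta ^+ 2 * rho2 ^+ 2)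
   + (kappa1 + 1) / (2 * beta ^+ 2 * rho2)) * (eta ^+ 2 * Lf ^+ 2)
  + eta ^+ 2 * (Lf / 2) =
  eta * (1 / 8 - eps5 rho2 Lf alpha beta + eta * eps6 rho2 Lf alpha beta).
  rewrite /eps5 /eps6 halpha.
  by field; rewrite !gt_eqF.
rewrite expr2 -mulrA -mulrDr ler_pM2l //.
lra.
Qed.

Lemma r_zero_ge0 : 0 <= r_zero phi r.
Proof.
case/andP: hphi => _ phi1; have h1 : 0 <= 1 - phi by rewrite subr_ge0.
by rewrite /r_zero addr_ge0 // mulr_ge0 ?sqr_ge0 // mulr_ge0 ?sqr_ge0.
Qed.

(** As (1 + c / 2) (1 - c) = 1 - e7, the claim is e9 eta^2 + e8 eta <= e7, and the last term of
    [kappa3] is the positive root of this quadratic. For r_0 = 0 both coefficients vanish. *)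
Lemma compression_margin :
  (eta * (alpha / 2 * rho + beta * rho + 2 * beta)
   + eta ^+ 2 * (3 * alpha ^+ 2 * rho ^+ 2 + 2 * beta ^+ 2 + 1
                 + N * (4 * (alpha ^+ 2 * rho ^+ 2)))) * r_zero phi r
  + (1 + c / 2) * (1 - c) <= 1.
Proof.
have /andP[c0 c1] := rate_bounds; have [k1 _] := kappa1_ge.
have b0 := beta_gt0.
have a0 := alpha_gt0.
set e7 := eps7 phi r psi; set e8 := eps8 rho phi r alpha beta.
set e9 := eps9 rho phi r alpha beta psi.
have -> : (eta * (alpha / 2 * rho + beta * rho + 2 * beta)
   + eta ^+ 2 * (3 * alpha ^+ 2 * rho ^+ 2 + 2 * beta ^+ 2 + 1
                 + N * (4 * (alpha ^+ 2 * rho ^+ 2)))) * r_zero phi r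
  + (1 + c / 2) * (1 - c) = 1 + (eta * e8 + eta ^+ 2 * e9 - e7).
  rewrite /e7 /e8 /e9 /eps7 /eps8 /eps9.
  by field; rewrite phi_neq0 psi_neq0 r_neq0.
rewrite gerDl subr_le0.
have e70 : 0 < e7 by rewrite /e7 /eps7 mulr_gt0 // ?divr_gt0 // addr_gt0.
case/andP: heta => _; rewrite /kappa3 -/e7 -/e8 -/e9.
have [r0|r0] := eqVneq (r_zero phi r) 0.
  move=> _; rewrite /e8 /e9 /eps8 /eps9 r0 !(mulr0, mul0r, addr0).
  exact: ltW.
have r0_gt0 : 0 < r_zero phi r by rewrite lt_def r0 r_zero_ge0.
have r0_ge0 := ltW r0_gt0.
have e80 : 0 <= e8.
  rewrite /e8 /eps8; apply: addr_ge0; rewrite !mulr_ge0 //.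
  by apply: addr_ge0; rewrite ?mulr_ge0.
have e90 : 0 < e9.
  rewrite /e9 /eps9 ltr_wpDl //.
    rewrite divr_ge0 // !mulr_ge0 ?sqr_ge0 //.
    by apply: addr_ge0; rewrite ?mulr_ge0.
  by rewrite mulr_gt0 // ltr_wpDl // mulr_ge0 ?sqr_ge0.
have e7_ge0 := ltW e70; have e9_ge0 := ltW e90.
rewrite lt_min => /andP[_]; rewrite ltr_pdivlMr ?mulr_gt0 // ltrBrDr => h.
have h0 : 0 <= eta * (2 * e9) + e8.
  by apply: addr_ge0 => //; exact: mulr_ge0 eta_ge0 (mulr_ge0 _ e9_ge0).
have D0 : 0 <= e8 ^+ 2 + 4 * e7 * e9.
  by apply: addr_ge0 (sqr_ge0 e8) _; apply: mulr_ge0 e9_ge0; exact: mulr_ge0.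
have : (eta * (2 * e9) + e8) ^+ 2 < e8 ^+ 2 + 4 * e7 * e9.
  by rewrite -[ltRHS]sqr_sqrtr // ltr_pXn2r // nnegrE sqrtr_ge0.
move=> h2; rewrite ltW //.
have : 4 * e9 * (eta * e8 + eta ^+ 2 * e9) < 4 * e9 * e7 by lra.
by rewrite ltr_pM2l // mulr_gt0.
Qed.

End parameters.

(** * The Lyapunov inequality *)

Section lyapunov.
Context {R : realType} {n d : nat}.
Variables (A : 'M[R]_n) (Q : 'M[R]_n).
Hypothesis n_ge2 : (2 <= n)%N.
Hypothesis hA : connected_weighted_graph A.
Local Notation L := (laplacian A).
Local Notation J := (@avg_mx R n).
Local Notation rho := (spectral_radius L).
Local Notation rho2 := (min_pos_eigenvalue L).
Hypothesis QL : Q *m L = 1%:M - J.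
Hypothesis LQ : L *m Q = 1%:M - J.
Hypothesis JQ : J *m Q = 0.
Variables (Lf phi r kappa1 kappa4 alpha beta eta psi : R).
Hypotheses (Lf_gt0 : 0 < Lf).
Hypotheses (hphi : 0 < phi <= 1) (hr : 0 < r) (hpsi : 0 < psi <= r^-1).
Hypothesis hkappa4 : 0 < kappa4.
Hypothesis hkappa1 : kappa1_bound rho2 kappa4 <= kappa1.
Hypothesis halpha : alpha = kappa1 * beta.
Hypothesis hbeta : kappa2 rho2 Lf kappa1 kappa4 < beta.
Hypothesis heta : 0 < eta < kappa3 rho rho2 Lf phi r alpha beta psi.

Local Notation c := (phi * psi * r).
Local Notation N := (1 + 2 / c).
Implicit Types X Y : 'M[R]_(n, d).

Definition center X : 'M[R]_(n, d) := (1%:M - J) *m X.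

Lemma centerE X : center X = X - J *m X.
Proof. by rewrite /center mulmxBl mul1mx. Qed.

Lemma avg_center X : J *m center X = 0.
Proof. by rewrite centerE mulmxBr mulmxA avg_mx_idem // subrr. Qed.

Lemma dot_center_avg X Y : dot (center X) (J *m Y) = 0.
Proof.
by rewrite dotC dot_mulmxl avg_mx_sym avg_center dotC dot0l.
Qed.

Lemma dot_sqrD X Y : dot (X + Y) (X + Y) = dot X X + 2 * dot X Y + dot Y Y.
Proof. by rewrite !dot_lin (dotC Y X); ring. Qed.

Lemma dot_center X :
  dot X X = dot (center X) (center X) + dot (J *m X) (J *m X).
Proof.
have {1 2}-> : X = center X + J *m X by rewrite centerE subrK.
by rewrite dot_sqrD dot_center_avg mulr0 addr0.
Qed.

Lemma dot_center_le X : dot (center X) (center X) <= dot X X.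
Proof. by rewrite [leRHS]dot_center lerDl dot_ge0. Qed.

Lemma dot_avg_le X : dot (J *m X) (J *m X) <= dot X X.
Proof. by rewrite [leRHS]dot_center lerDr dot_ge0. Qed.

Lemma centerD X Y : center (X + Y) = center X + center Y.
Proof. by rewrite /center mulmxDr. Qed.

Lemma centerN X : center (- X) = - center X.
Proof. by rewrite /center mulmxN. Qed.

Lemma centerB X Y : center (X - Y) = center X - center Y.
Proof. by rewrite /center mulmxBr. Qed.

Lemma centerZ k X : center (k *: X) = k *: center X.
Proof. by rewrite /center -scalemxAr. Qed.

Definition consensus_rate : R :=
  eta * (alpha / 2 * rho2 - 9 / 8 * beta - 1 - 5 / 4 * Lf ^+ 2
      - eta * (3 * alpha ^+ 2 * rho ^+ 2 + 2 * beta ^+ 2 + 1 + 5 / 2 * Lf ^+ 2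
               + N * (4 * (alpha ^+ 2 * rho ^+ 2 + Lf ^+ 2)))).

(** The terms without [N] come from [saddle_step], the term with [N] from the motion of x inside |x
    - a|^2. *)
Definition compression_gain : R :=
  eta * (alpha / 2 * rho + beta * rho + 2 * beta)
   + eta ^+ 2 * (3 * alpha ^+ 2 * rho ^+ 2 + 2 * beta ^+ 2 + 1
                 + N * (4 * (alpha ^+ 2 * rho ^+ 2))).

Lemma compression_gain_ge0 : 0 <= compression_gain.
Proof.
have [rho2_gt0 rho2_le _ _ _] := laplacian_bounds n_ge2 hA.
have rho_ge0 : 0 <= rho by apply: le_trans rho2_le; exact: ltW.
have b0 := beta_gt0 rho2_gt0 hbeta.
have eta0 : 0 < eta by case/andP: heta.
have /andP[c0 c1] := rate_bounds hphi hr hpsi.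
have N0 : 0 <= N by rewrite addr_ge0 // divr_ge0 // ltW.
have e20 := sqr_ge0 eta.
have a0 := ltW (alpha_gt0 rho2_gt0 hkappa4 hkappa1 halpha hbeta).
have b0' := ltW b0; have ar := mulr_ge0 (sqr_ge0 alpha) (sqr_ge0 rho).
have br := mulr_ge0 b0' rho_ge0; have ar' := mulr_ge0 a0 rho_ge0.
have bb := sqr_ge0 beta; have Nar := mulr_ge0 N0 ar.
rewrite /compression_gain; apply: addr_ge0; apply: mulr_ge0 => //.
  exact: ltW.
  lra.
lra.
Qed.

(** [G] and [G0] play the stacked gradients at the agents and at their average, and [F] plays n
    (f(xbar) - fstar). The functions enter only through Lipschitz bounds and a descent inequality,
    and [q] is arbitrary, so the step is purely deterministic. *)
Lemma lyapunov_step (X a q v G G0 G0' : 'M[R]_(n, d)) (F F' : R) :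
  let X' := X - (eta * alpha) *: (L *m (a + q)) - eta *: (beta *: v + G) in
  let v' := v + (eta * beta) *: (L *m (a + q)) in
  let a' := a + psi *: q in
  J *m v = 0 ->
  dot (G - G0) (G - G0) <= Lf ^+ 2 * dot (center X) (center X) ->
  dot (G0' - G0) (G0' - G0) <=
    Lf ^+ 2 * dot (J *m X' - J *m X) (J *m X' - J *m X) ->
  F' <= F - eta * dot (J *m G0) (J *m G)
        + eta ^+ 2 * (Lf / 2) * dot (J *m G) (J *m G) ->
  ((saddle L kappa1 (center X') (Q *m (v' + beta^-1 *: G0')) + F'
    + dot (X' - a') (X' - a'))
   + (consensus_rate * dot (center X) (center X)
      + eta / 2 * dot (J *m G0) (J *m G0))
  <= saddle L kappa1 (center X) (Q *m (v + beta^-1 *: G0)) + F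
     + compression_gain * dot (a + q - X) (a + q - X)
     + (1 + c / 2) * dot (X - a') (X - a') : Prop).
Proof.
move=> X' v' a' Jv hG hG0 hF.
have [rho2_gt0 rho2_le L_le L_le2 L_gap] := laplacian_bounds n_ge2 hA.
have rho_ge0 : 0 <= rho by apply: le_trans rho2_le; exact: ltW.
have Lsym := laplacian_sym hA.
have LJ : L *m J = 0 := laplacian_avg A.
have JL : J *m L = 0 := avg_laplacian hA.
have b0 := beta_gt0 rho2_gt0 hbeta.
have eta0 : 0 < eta by case/andP: heta.
have [k1 k2] := kappa1_ge rho2_gt0 hkappa4 hkappa1.
have /andP[c0 c1] := rate_bounds hphi hr hpsi.
set z := center X; set w := v + beta^-1 *: G0; set s := Q *m w.
set e := center (a + q - X); set dl := center (G - G0).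
set t := Q *m (G0' - G0); set h := J *m G.
have pE : z + e = center (a + q).
  by rewrite /z /e -centerD addrC subrK.
have LpE : L *m (z + e) = L *m (a + q).
  by rewrite pE /center mulmxA mulmxBr mulmx1 LJ subr0.
have LsE : L *m s = center w by rewrite /s mulmxA LQ.
have KvE : center v = v by rewrite centerE Jv subr0.
(* Since beta L s = beta v + center G0, adding [dl] replaces the gradients at the average by those
   at the agents. This puts the centered iterate in the form of [saddle_step]. *)
have GdE : alpha *: (L *m (z + e)) + beta *: (L *m s) + dl =
    alpha *: (L *m (a + q)) + beta *: v + center G.
  rewrite LpE LsE /dl centerB /w centerD KvE centerZ scalerDr scalerA.
  rewrite divff ?gt_eqF // scale1r -!addrA; congr (_ + (_ + _)).
   exact: subrKC.
set Gd := alpha *: (L *m (z + e)) + beta *: (L *m s) + dl in GdE *.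
have zE : center X' = z - eta *: Gd.
  rewrite GdE /X' !(centerD, centerN, centerZ) KvE.
  rewrite [center (L *m _)]centerE mulmxA JL mul0mx subr0.
  rewrite [eta *: (_ + _ + _)]scalerDr -addrA -opprD.
  by rewrite !scalerDr !scalerA addrA.
have sE : Q *m (v' + beta^-1 *: G0') =
    s + (eta * beta) *: (z + e) + beta^-1 *: t.
  have -> : v' + beta^-1 *: G0' =
      w + (eta * beta) *: (L *m (a + q)) + beta^-1 *: (G0' - G0).
    rewrite /w /v' scalerBr -!addrA; congr (_ + _).
    by rewrite [RHS]addrCA subrKC.
  by rewrite 2!mulmxDr -!scalemxAr mulmxA QL pE.
(* J annihilates both L and v, so the average moves by the mean gradient alone. *)
have JX : J *m X' - J *m X = - (eta *: h).
  rewrite /X' 2!mulmxBr -!scalemxAr [J *m (_ *: v + _)]mulmxDr -scalemxAr Jv.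
  rewrite mulmxA JL mul0mx.
  by rewrite !scaler0 subr0 add0r addrAC subrr add0r.
have Jz : J *m z = 0 := avg_center X.
have Js : J *m s = 0 by rewrite /s mulmxA JQ mul0mx.
have Jt : J *m t = 0 by rewrite /t mulmxA JQ mul0mx.
have step := @saddle_step R n d L rho rho2 Lsym rho2_gt0 rho_ge0
  (fun Y => L_le d Y) (fun Y => L_le2 d Y) (fun Y => dot_laplacian_ge0 hA Y)
  kappa1 alpha beta eta z e s dl t b0 eta0 k1 halpha
  (L_gap _ _ Jz) (L_gap _ _ Js) (L_gap _ _ Jt).
rewrite -/Gd -zE -sE in step.
have S0 : 0 <= dot s (L *m s) := dot_laplacian_ge0 hA s.
have H0 := dot_ge0 h.
have D1 : dot dl dl <= Lf ^+ 2 * dot z z := le_trans (dot_center_le _) hG.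
have D2 : dot e e <= dot (a + q - X) (a + q - X) := dot_center_le _.
have LtE : L *m t = center (G0' - G0) by rewrite /t mulmxA LQ.
have D3 : dot (L *m t) (L *m t) <= eta ^+ 2 * Lf ^+ 2 * dot h h.
  rewrite LtE; apply: (le_trans (dot_center_le _)); apply: (le_trans hG0).
  by rewrite JX dotNl dotNr dotZl dotZr; lra.
(* Polarization. Half of |J G0|^2 becomes the dissipation, while half of |h|^2 is what
   [gradient_margin] spends on the drift of the dual variable. *)
have D4 : - dot (J *m G0) h <=
    - dot (J *m G0) (J *m G0) / 2 - dot h h / 2 + Lf ^+ 2 / 2 * dot z z.
  have := le_trans (dot_avg_le (G - G0)) hG; rewrite mulmxBr -/h -/z.
  rewrite !(dotDl, dotDr, dotNl, dotNr) (dotC h); lra.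
have hL2 (Y : 'M[R]_(n, d)) : dot (L *m Y) (L *m Y) <= rho ^+ 2 * dot Y Y.
  apply: (le_trans (L_le _ Y)); rewrite expr2 -mulrA.
  by apply: ler_wpM2l.
have D5 : dot Gd Gd <= 4 * (alpha ^+ 2 * rho ^+ 2 * (dot z z + dot e e)
    + beta ^+ 2 * rho * dot s (L *m s) + Lf ^+ 2 * dot z z).
  have four (U V W Y : 'M[R]_(n, d)) : dot (U + V + W + Y) (U + V + W + Y) <=
      4 * (dot U U + dot V V + dot W W + dot Y Y).
    have := dot_ge0 (U - V); have := dot_ge0 (U - W); have := dot_ge0 (U - Y).
    have := dot_ge0 (V - W); have := dot_ge0 (V - Y); have := dot_ge0 (W - Y).
    rewrite !dot_lin (dotC V U) (dotC W U) (dotC Y U) (dotC W V) (dotC Y V).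
    rewrite (dotC Y W); lra.
  have := four (alpha *: (L *m z)) (alpha *: (L *m e)) (beta *: (L *m s)) dl.
  rewrite -scalerDr -mulmxDr -/Gd.
  rewrite ![dot (_ *: _) _]dotZl ![dot _ (_ *: _)]dotZr.
  have := ler_wpM2l (sqr_ge0 alpha) (hL2 z).
  have := ler_wpM2l (sqr_ge0 alpha) (hL2 e).
  have := ler_wpM2l (sqr_ge0 beta) (L_le _ s).
  lra.
have XX : dot (X' - X) (X' - X) = eta ^+ 2 * (dot Gd Gd + dot h h).
  rewrite dot_center centerB zE -/z mulmxBr JX.
  rewrite [z - _]addrC addrK !(dotNl, dotNr, dotZl, dotZr).
  ring.
(* Young with weight c / 2, the origin of [N]; the factor 1 + c / 2 is later offset by the
   contraction 1 - c. *)
have D6 : dot (X' - a') (X' - a') <=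
    (1 + c / 2) * dot (X - a') (X - a') + N * dot (X' - X) (X' - X).
  have -> : X' - a' = (X - a') + (X' - X) by rewrite [RHS]addrC addrA subrK.
  move: (X - a') (X' - X) => U W.
  have := dot_ge0 ((c / 2) *: U - W); rewrite !dot_lin (dotC W U).
  move=> hU.
  have i0 : 0 <= 2 / c by rewrite divr_ge0 // ltW.
  have := ler_wpM2l i0 hU; rewrite mulr0.
  have kk : 2 / c * (c / 2) = 1.
    by rewrite mulrA divfK ?divff // gt_eqF.
  move: hU i0 kk; move: (c / 2) (2 / c) => k k' hU i0 kk.
  have E1 : k' * (k * (k * dot U U)) = k * dot U U.
    by rewrite [LHS]mulrA kk mul1r.
  have E2 : k' * (k * dot U W) = dot U W by rewrite [LHS]mulrA kk mul1r.
  have := ler_wpM2l i0 hU; rewrite mulr0; lra.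
rewrite XX in D6.
have M1 := dual_margin rho2_gt0 rho2_le Lf_gt0 hphi hr hpsi hkappa4 hkappa1
  halpha hbeta heta.
have M2 := gradient_margin rho2_gt0 rho2_le Lf_gt0 hphi hr hpsi hkappa4 hkappa1
  halpha hbeta heta.
move: step M2.
set Cq := (X in X * dot (L *m t) _).
move=> step M2'.
have {M2'} M2 : Cq * (eta ^+ 2 * Lf ^+ 2) + eta ^+ 2 * (Lf / 2) + eta ^+ 2 * N
  <= eta / 2 := M2'.
have Cq0 : 0 <= Cq.
  by rewrite /Cq !addr_ge0 ?divr_ge0 ?mulr_ge0 ?exprn_ge0 ?addr_ge0 //
    ?(ltW b0) ?(ltW eta0) ?(ltW rho2_gt0) //; apply: le_trans k1.
have H1 := ler_wpM2l Cq0 D3.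
have H2 := ler_wpM2r H0 M2.
have H3 := mulr_ge0 (mulr_ge0 (ltW eta0) M1) S0.
have N0 : 0 <= N by rewrite addr_ge0 // divr_ge0 // ltW.
have e20 := sqr_ge0 eta.
have H4 := ler_wpM2l (mulr_ge0 N0 e20) D5.
have H5 := ler_wpM2l (ltW eta0) D1.
have H6 := ler_wpM2l e20 D1.
have H7 := ler_wpM2l (ltW eta0) D4.
have B0 := compression_gain_ge0.
have H8 := ler_wpM2l B0 D2.
rewrite /consensus_rate; rewrite /compression_gain in H8 *.
move: step D6 hF H1 H2 H3 H4 H5 H6 H7 H8.
rewrite -/h -/z.
(* All products have been formed; with the inner products as variables, the claim is a linear
   combination of the collected inequalities. *)
clear Cq0 M2; move: Cq N.
move: (saddle _ _ _ _) (saddle _ _ _ _) (dot (L *m t) _) (dot Gd _)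
  (dot (X' - a') _) (dot (X - a') _) (dot (a + q - X) _) (dot (J *m G0) h)
  (dot (J *m G0) _) (dot h h) (dot dl dl) (dot s _) (dot e e) (dot z z).
by move=> *; lra.
Qed.
End lyapunov.

(** * The algorithm in stacked form *)

Section stack.
Context {R : realType} {n d : nat}.
Implicit Types u v : 'I_n -> 'rV[R]_d.

Definition stack u : 'M[R]_(n, d) := \matrix_i u i.

Lemma stackD u v : stack u + stack v = stack (fun i => u i + v i).
Proof. by apply/matrixP => i j; rewrite !mxE. Qed.

Lemma stackN u : - stack u = stack (fun i => - u i).
Proof. by apply/matrixP => i j; rewrite !mxE. Qed.

Lemma stackB u v : stack u - stack v = stack (fun i => u i - v i).
Proof. by rewrite stackN stackD. Qed.

Lemma stackZ k u : k *: stack u = stack (fun i => k *: u i).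
Proof. by apply/matrixP => i j; rewrite !mxE. Qed.

Lemma mulmx_stack (M : 'M[R]_n) u :
  M *m stack u = stack (fun i => \sum_j M i j *: u j).
Proof.
apply/matrixP => i l; rewrite !mxE summxE.
by apply: eq_bigr => j _; rewrite !mxE.
Qed.

Lemma avg_stack u : avg_mx *m stack u = stack (fun=> mean_vec u).
Proof.
apply/matrixP => i l; rewrite avg_mxE !mxE summxE.
by congr (_ * _); apply: eq_bigr => j _; rewrite mxE.
Qed.

Lemma dot_stack u v : dot (stack u) (stack v) = \sum_i dot (u i) (v i).
Proof.
rewrite dotE; apply: eq_bigr => i _; rewrite dotE big_ord1.
by apply: eq_bigr => j _; rewrite !mxE.
Qed.

Lemma center_stack u : center (stack u) = stack (fun i => u i - mean_vec u).
Proof. by rewrite centerE avg_stack stackB. Qed.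

Lemma eq_stack u v : u =1 v -> stack u = stack v.
Proof. by move=> uv; apply/matrixP => i j; rewrite !mxE uv. Qed.

Lemma grad_mean_fun (f : 'I_n -> 'rV[R]_d -> R) x :
  (forall i, differentiable (f i) x) ->
  grad (mean_fun f) x = mean_vec (fun i => grad (f i) x).
Proof.
move=> df; apply/rowP => j; rewrite !mxE summxE.
have -> : mean_fun f = n%:R^-1 *: \sum_i f i.
  by apply/funext => y; rewrite /mean_fun fctE fct_sumE.
rewrite deriveZ; last first.
  by apply: derivable_sum => i; exact: diff_derivable.
rewrite derive_sum => [|i]; last exact: diff_derivable.
by congr (_ * _); apply: eq_bigr => i _; rewrite mxE.
Qed.

End stack.

Section trajectory.
Context {R : realType} {n d : nat}.
Variables (A Li : 'M[R]_n).
Hypothesis n_ge2 : (2 <= n)%N.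
Hypothesis hA : connected_weighted_graph A.
Local Notation L := (laplacian A).
Local Notation J := (@avg_mx R n).
Local Notation rho := (spectral_radius L).
Local Notation rho2 := (min_pos_eigenvalue L).
Hypothesis LiL : Li *m L = 1%:M - J.
Hypothesis LLi : L *m Li = 1%:M - J.
Hypothesis JLi : J *m Li = 0.
Variables (f : 'I_n -> 'rV[R]_d -> R) (Lf fstar : R).
Hypothesis Lf_gt0 : 0 < Lf.
Hypothesis hdiff : forall i x, differentiable (f i) x.
Hypothesis hlip : forall i x y,
  enorm (grad (f i) x - grad (f i) y) <= Lf * enorm (x - y).
Variables (phi r kappa1 kappa4 alpha beta eta psi : R).
Hypotheses (hphi : 0 < phi <= 1) (hr : 0 < r) (hpsi : 0 < psi <= r^-1).
Hypothesis hkappa4 : 0 < kappa4.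
Hypothesis hkappa1 : kappa1_bound rho2 kappa4 <= kappa1.
Hypothesis halpha : alpha = kappa1 * beta.
Hypothesis hbeta : kappa2 rho2 Lf kappa1 kappa4 < beta.
Hypothesis heta : 0 < eta < kappa3 rho rho2 Lf phi r alpha beta psi.
Variables (C : 'I_n -> nat -> 'rV[R]_d -> 'rV[R]_d) (x0 : 'I_n -> 'rV[R]_d).
Variables (a b v x q : 'I_n -> nat -> 'rV[R]_d).
Hypothesis halg :
  compressed_primal_dual L f alpha beta eta psi C x0 a b v x q.

Local Notation c := (phi * psi * r).
Local Notation X k := (stack (fun i => x i k)).
Local Notation AA k := (stack (fun i => a i k)).
Local Notation VV k := (stack (fun i => v i k)).
Local Notation QQ k := (stack (fun i => q i k)).
Local Notation xbar k := (mean_vec (fun i => x i k)).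
Local Notation GG k := (stack (fun i => grad (f i) (x i k))).

Lemma grad_lip i y z :
  dot (grad (f i) y - grad (f i) z) (grad (f i) y - grad (f i) z) <=
  Lf ^+ 2 * dot (y - z) (y - z).
Proof.
rewrite -!enorm_sqr -exprMn lerXn2r ?nnegrE ?enorm_ge0 //.
by rewrite mulr_ge0 ?enorm_ge0 // ltW.
Qed.

Lemma q_compressed i k : q i k = C i k (x i k - a i k).
Proof.
case: halg => xi ai _ _ qi _ _ _ _ qs; case: k => [|k]; last exact: qs.
by rewrite qi xi ai subr0.
Qed.

(** Both sides start at 0 and gain psi L q in every round. *)
Lemma ab_laplacian k : stack (fun i => a i k - b i k) = L *m AA k.
Proof.
case: halg => _ ai bi _ _ astep bstep _ _ _.
elim: k => [|k IHk].
  have -> : AA 0%N = 0 by apply/matrixP => i j; rewrite !mxE ai mxE.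
  rewrite mulmx0; apply/matrixP => i j.
  by rewrite !mxE ai bi !mxE subrr.
have -> : AA k.+1 = AA k + psi *: QQ k.
  by rewrite stackZ stackD; apply: eq_stack => i; rewrite astep.
rewrite mulmxDr -IHk -scalemxAr mulmx_stack stackZ stackD.
apply: eq_stack => i; rewrite astep bstep scalerBr opprD opprB.
by rewrite addrACA [psi *: _ + _]addrC subrK.
Qed.

Lemma consensus_input k :
  stack (fun i => a i k - b i k + \sum_j L i j *: q j k) =
  L *m (AA k + QQ k).
Proof. by rewrite mulmxDr -ab_laplacian mulmx_stack stackD. Qed.

Lemma a_stack k : AA k.+1 = AA k + psi *: QQ k.
Proof.
case: halg => _ _ _ _ _ astep _ _ _ _.
by rewrite stackZ stackD; apply: eq_stack => i; rewrite astep.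
Qed.

Lemma v_stack k : VV k.+1 = VV k + (eta * beta) *: (L *m (AA k + QQ k)).
Proof.
case: halg => _ _ _ _ _ _ _ _ vstep _.
rewrite -consensus_input stackZ stackD.
by apply: eq_stack => i; rewrite vstep.
Qed.

Lemma x_stack k : X k.+1 = X k - (eta * alpha) *: (L *m (AA k + QQ k))
  - eta *: (beta *: VV k + GG k).
Proof.
case: halg => _ _ _ _ _ _ _ xstep _ _.
rewrite -consensus_input !(stackZ, stackD, stackB).
by apply: eq_stack => i; rewrite xstep.
Qed.

(** v starts at 0 and moves within the range of L, on which J vanishes. *)
Lemma avg_v k : J *m VV k = 0.
Proof.
case: halg => _ _ _ vi _ _ _ _ _ _.
elim: k => [|k IHk].
  rewrite (_ : VV 0%N = 0) ?mulmx0 //.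
  by apply/matrixP => i j; rewrite !mxE vi mxE.
rewrite v_stack mulmxDr IHk -scalemxAr mulmxA avg_laplacian //.
by rewrite mul0mx scaler0 addr0.
Qed.

Definition gradbar k : 'M[R]_(n, d) := stack (fun i => grad (f i) (xbar k)).

Definition potential k : R :=
  saddle L kappa1 (center (X k)) (Li *m (VV k + beta^-1 *: gradbar k))
  + n%:R * (mean_fun f (xbar k) - fstar).

Definition dissipation k : R :=
  consensus_rate A Lf phi r alpha beta eta psi
    * dot (center (X k)) (center (X k))
  + eta / 2 * dot (J *m gradbar k) (J *m gradbar k).

Lemma potential_step k :
  potential k.+1 + dot (X k.+1 - AA k.+1) (X k.+1 - AA k.+1) + dissipation k
  <= potential k
     + compression_gain A phi r alpha beta eta psi
       * dot (AA k + QQ k - X k) (AA k + QQ k - X k)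
     + (1 + c / 2) * dot (X k - (AA k + psi *: QQ k))
                         (X k - (AA k + psi *: QQ k)).
Proof.
have n0 : n%:R != 0 :> R by rewrite pnatr_eq0 -lt0n ltnW.
have arith (u' u s p q0 : R) : u' <= u - p + q0 -> u' - s <= u - s - p + q0.
  lra.
have step := @lyapunov_step R n d A Li n_ge2 hA LiL LLi JLi Lf phi r kappa1
  kappa4 alpha beta eta psi Lf_gt0 hphi hr hpsi hkappa4 hkappa1 halpha hbeta
  heta (X k) (AA k) (QQ k) (VV k) (GG k) (gradbar k) (gradbar k.+1)
  (n%:R * (mean_fun f (xbar k) - fstar))
  (n%:R * (mean_fun f (xbar k.+1) - fstar)).
rewrite /= -x_stack -v_stack -a_stack in step.
rewrite /potential /dissipation a_stack; rewrite a_stack in step.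
apply: step; first exact: avg_v.
- rewrite center_stack /gradbar stackB !dot_stack mulr_sumr.
  by apply: ler_sum => i _; exact: grad_lip.
- rewrite /gradbar stackB !avg_stack stackB !dot_stack mulr_sumr.
  by apply: ler_sum => i _; exact: grad_lip.
have JX : J *m X k.+1 = J *m X k - eta *: (J *m GG k).
  rewrite x_stack !mulmxBr -!scalemxAr [J *m (_ *: VV k + _)]mulmxDr.
  rewrite -scalemxAr avg_v.
  by rewrite mulmxA avg_laplacian // mul0mx !scaler0 subr0 add0r.
have f_step i (y u : 'rV[R]_d) : f i (y + - eta *: u) <=
    f i y - eta * dot (grad (f i) y) u + eta ^+ 2 * (Lf / 2) * dot u u.
  have := descent y (- eta *: u) Lf_gt0 (hdiff i) (grad_lip i).
  by rewrite !(dotZl, dotZr); lra.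
(* The descent lemma is applied to every f_i at the common point xbar with the common step - eta g.
   Summing over the agents yields n f, and the n copies of |g|^2 make up |J G|^2. *)
pose g := mean_vec (fun i => grad (f i) (x i k)).
have xE : xbar k.+1 = xbar k + - eta *: g.
  have /(congr1 (row (Ordinal (ltnW n_ge2)))) := JX.
  rewrite !avg_stack stackZ stackB !rowK => ->.
  by rewrite scaleNr.
have F_step : n%:R * mean_fun f (xbar k.+1) <= n%:R * mean_fun f (xbar k)
    - eta * \sum_i dot (grad (f i) (xbar k)) g
    + eta ^+ 2 * (Lf / 2) * \sum_(i < n) dot g g.
  rewrite /mean_fun !mulVKf // [eta * \sum_i _]mulr_sumr.
  rewrite [_ * \sum_(i < n) dot g g]mulr_sumr -sumrB -big_split /=.
  apply: ler_sum => i _; rewrite xE.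
  exact: f_step.
have gE : dot (J *m GG k) (J *m GG k) = \sum_(i < n) dot g g.
  by rewrite avg_stack dot_stack.
have gbE : dot (J *m gradbar k) (J *m GG k) =
    \sum_i dot (grad (f i) (xbar k)) g.
  rewrite dot_mulmxl avg_mx_sym mulmxA (avg_mx_idem n_ge2).
  by rewrite avg_stack /gradbar dot_stack.
rewrite gE gbE !mulrBr; exact: arith F_step.
Qed.

End trajectory.

(** * Expectations *)

(** Phrased with additions only, so it is valid even for infinite integrals. In the application [u]
    is the potential, [y] is |x - a|^2, [D] the dissipation, and [e1], [e2] are the two terms
    containing a fresh compression; [g * r1 + h * r2 <= 1] lets [y] absorb both. *)
Lemma ge0_integral_descent (R : realType) (dT : measure_display)
    (T : measurableType dT) (m : {measure set T -> \bar R})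
    (u u' y y' D e1 e2 : T -> R) (g h r1 r2 : R) :
  measurable_fun [set: T] u -> measurable_fun [set: T] u' ->
  measurable_fun [set: T] y -> measurable_fun [set: T] y' ->
  measurable_fun [set: T] D -> measurable_fun [set: T] e1 ->
  measurable_fun [set: T] e2 ->
  (forall w, 0 <= u w) -> (forall w, 0 <= u' w) -> (forall w, 0 <= y w) ->
  (forall w, 0 <= y' w) -> (forall w, 0 <= D w) -> (forall w, 0 <= e1 w) ->
  (forall w, 0 <= e2 w) -> 0 <= g -> 0 <= h -> 0 <= r1 -> 0 <= r2 ->
  (forall w, u' w + y' w + D w <= u w + g * e1 w + h * e2 w) ->
  (\int[m]_w (e1 w)%:E <= r1%:E * \int[m]_w (y w)%:E)%E ->
  (\int[m]_w (e2 w)%:E <= r2%:E * \int[m]_w (y w)%:E)%E ->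
  g * r1 + h * r2 <= 1 ->
  (\int[m]_w (u' w + y' w)%:E + \int[m]_w (D w)%:E <=
   \int[m]_w (u w + y w)%:E)%E.
Proof.
move=> mu mu' my my' mD me1 me2 u0 u'0 y0 y'0 D0 e10 e20 g0 h0 r10 r20.
move=> udesc e1y e2y ghr.
have Iy0 : (0 <= \int[m]_w (y w)%:E)%E.
  by apply: integral_ge0 => w _; rewrite lee_fin.
rewrite -ge0_integralD //; last 4 first.
- by move=> w _; rewrite lee_fin addr_ge0.
- by apply/measurable_EFinP; exact: measurable_funD.
- by move=> w _; rewrite lee_fin.
- exact/measurable_EFinP.
apply: (@le_trans _ _ (\int[m]_w ((u w)%:E + (g%:E * (e1 w)%:E
    + h%:E * (e2 w)%:E)))%E).
  apply: ge0_le_integral => //.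
  - by move=> w _; rewrite -EFinD lee_fin !addr_ge0.
  - apply: emeasurable_funD; apply/measurable_EFinP => //.
    exact: measurable_funD.
  - apply: emeasurable_funD; first exact/measurable_EFinP.
    by apply: emeasurable_funD; apply: measurable_funeM; exact/measurable_EFinP.
  - by move=> w _; rewrite -!EFinM -!EFinD lee_fin addrA.
have mge : measurable_fun [set: T] (fun w => g%:E * (e1 w)%:E)%E.
  by apply: measurable_funeM; exact/measurable_EFinP.
have mhe : measurable_fun [set: T] (fun w => h%:E * (e2 w)%:E)%E.
  by apply: measurable_funeM; exact/measurable_EFinP.
rewrite ge0_integralD //; last 4 first.
- by move=> w _; rewrite lee_fin.
- exact/measurable_EFinP.
- by move=> w _; rewrite -!EFinM -EFinD lee_fin addr_ge0 // mulr_ge0.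
- exact: emeasurable_funD.
rewrite ge0_integralD //; last 2 first.
- by move=> w _; rewrite -EFinM lee_fin mulr_ge0.
- by move=> w _; rewrite -EFinM lee_fin mulr_ge0.
rewrite !ge0_integralZl_EFin //; last 4 first.
- by move=> w _; rewrite lee_fin.
- exact/measurable_EFinP.
- by move=> w _; rewrite lee_fin.
- exact/measurable_EFinP.
under [in leRHS]eq_integral do rewrite EFinD.
rewrite [in leRHS]ge0_integralD //; last 4 first.
- by move=> w _; rewrite lee_fin.
- exact/measurable_EFinP.
- by move=> w _; rewrite lee_fin.
- exact/measurable_EFinP.
rewrite leeD2l //.
apply: (@le_trans _ _ ((g * r1 + h * r2)%:E * \int[m]_w (y w)%:E)%E).
  rewrite EFinD ge0_muleDl ?lee_fin ?mulr_ge0 //.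
  by rewrite !EFinM -!muleA leeD // lee_wpmul2l // lee_fin.
by rewrite -[leRHS]mul1e lee_wpmul2r // lee_fin.
Qed.

(** * Adaptedness of the iterates to the seeds *)

Section adapted.
Context {R : realType} {n d : nat} {dO dS : measure_display}.
Context {Omega : measurableType dO} {S : measurableType dS}.
Variables (P : probability Omega R) (mu : probability S R).
Variable xi : 'I_n -> nat -> Omega -> S.
Hypothesis hxi : fresh_seeds P mu xi.
Variables (C : S -> 'rV[R]_d -> 'rV[R]_d) (phi r : R).
Hypothesis hC : compressor mu C phi r.
Variables (A : 'M[R]_n) (f : 'I_n -> 'rV[R]_d -> R) (Lf : R).
Local Notation L := (laplacian A).
Hypothesis hlip : forall i x y,
  dot (grad (f i) x - grad (f i) y) (grad (f i) x - grad (f i) y)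
  <= Lf ^+ 2 * dot (x - y) (x - y).
Variables (alpha beta eta psi : R) (x0 : 'I_n -> 'rV[R]_d).
Variables (a b v x q : 'I_n -> nat -> Omega -> 'rV[R]_d).
Hypothesis halg : forall w, compressed_primal_dual L f alpha beta eta psi
  (fun i k => C (xi i k w)) x0
  (fun i k => a i k w) (fun i k => b i k w) (fun i k => v i k w)
  (fun i k => x i k w) (fun i k => q i k w).

Definition adapted k m p (X : Omega -> 'M[R]_(m, p)) : Prop :=
  @coord_measurable R _ (g_sigma_algebraType (past xi k)) m p X.

Lemma adapted_le k l m p (X : Omega -> 'M[R]_(m, p)) : (k <= l)%N ->
  adapted k X -> adapted l X.
Proof.
move=> kl mX i j _ B mB; have := mX i j measurableT B mB.
apply: smallest_sub; first exact: smallest_sigma_algebra.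
apply: subset_trans (past_subset kl) _; exact: sub_sigma_algebra.
Qed.

Lemma adapted_measurable k m p (X : Omega -> 'M[R]_(m, p)) :
  adapted k X -> coord_measurable X.
Proof.
move=> mX i j _ B mB; have := mX i j measurableT B mB.
apply: smallest_sub; first exact: sigma_algebra_measurable.
exact: (past_measurable hxi).
Qed.

Lemma sqr_coord_le_dot (u : 'rV[R]_d) j : u 0 j ^+ 2 <= dot u u.
Proof.
rewrite dotE big_ord1 (bigD1 j) //= expr2 lerDl.
by apply: sumr_ge0 => l _; exact: sqr_ge0.
Qed.

(** The Lipschitz bound makes every coordinate of the gradient continuous. *)
Lemma coord_measurable_grad dT (T : measurableType dT) i
    (X : T -> 'rV[R]_d) :
  coord_measurable X -> coord_measurable (fun w => grad (f i) (X w)).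
Proof.
move=> mX i0 j; rewrite (ord1 i0).
apply: (measurable_continuous (phi := fun y => grad (f i) y 0 j)) => //.
apply: (@euclidean_lipschitz_continuous _ _ _ (Lf ^+ 2)) => [|y z].
  exact: sqr_ge0.
apply: le_trans (hlip i y z); apply: le_trans (sqr_coord_le_dot _ j).
by rewrite !mxE.
Qed.

Lemma adapted_q i k :
  (forall i, adapted k (x i k)) -> (forall i, adapted k (a i k)) ->
  adapted k.+1 (q i k).
Proof.
move=> mx ma.
have -> : q i k = fun w => C (xi i k w) (x i k w - a i k w).
  by apply/funext => w; rewrite (q_compressed (halg w)).
apply: (measurable_compressor hC); first exact: past_seed.
apply: (@adapted_le k) => //.
by apply: coord_measurableB; [exact: mx|exact: ma].
Qed.

(** The index counts: iterates of round k use seeds of rounds below k only, whereas q of round k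
    needs [k.+1]. This makes the seed producing q independent of the vector being compressed. *)
Lemma adapted_iterates k i :
  [/\ adapted k (x i k), adapted k (a i k), adapted k (b i k)
    & adapted k (v i k)].
Proof.
elim: k i => [|k IHk] i.
  split.
  - have -> : x i 0%N = fun=> x0 i by apply/funext => w; case: (halg w) => ->.
    exact: coord_measurable_cst.
  - have -> : a i 0%N = fun=> 0 by apply/funext => w; case: (halg w) => _ ->.
    exact: coord_measurable_cst.
  - have -> : b i 0%N = fun=> 0 by apply/funext => w; case: (halg w) => _ _ ->.
    exact: coord_measurable_cst.
  - have -> : v i 0%N = fun=> 0.
      by apply/funext => w; case: (halg w) => _ _ _ ->.
    exact: coord_measurable_cst.
have mx j : adapted k.+1 (x j k).
  by apply: (@adapted_le k) => //; have [] := IHk j.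
have ma j : adapted k.+1 (a j k).
  by apply: (@adapted_le k) => //; have [] := IHk j.
have mb j : adapted k.+1 (b j k).
  by apply: (@adapted_le k) => //; have [] := IHk j.
have mv j : adapted k.+1 (v j k).
  by apply: (@adapted_le k) => //; have [] := IHk j.
have mq j : adapted k.+1 (q j k).
  by apply: adapted_q => l; have [] := IHk l.
have mLq : adapted k.+1 (fun w => \sum_(j < n) L i j *: q j k w).
  by apply: coord_measurable_sum => j; apply: coord_measurableZ; exact: mq.
have mc : adapted k.+1
    (fun w => a i k w - b i k w + \sum_(j < n) L i j *: q j k w).
  apply: coord_measurableD; last exact: mLq.
  by apply: coord_measurableB; [exact: ma|exact: mb].
split.
- have -> : x i k.+1 = fun w => x i k w
      - (eta * alpha) *: (a i k w - b i k w + \sum_(j < n) L i j *: q j k w)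
      - eta *: (beta *: v i k w + grad (f i) (x i k w)).
    by apply/funext => w; case: (halg w) => _ _ _ _ _ _ _ ->.
  apply: coord_measurableB.
    apply: coord_measurableB; first exact: mx.
    by apply: coord_measurableZ; exact: mc.
  apply: coord_measurableZ; apply: coord_measurableD.
    by apply: coord_measurableZ; exact: mv.
  by apply: coord_measurable_grad; exact: mx.
- have -> : a i k.+1 = fun w => a i k w + psi *: q i k w.
    by apply/funext => w; case: (halg w) => _ _ _ _ _ ->.
  apply: coord_measurableD; first exact: ma.
  by apply: coord_measurableZ; exact: mq.
- have -> : b i k.+1 = fun w =>
      b i k w + psi *: (q i k w - \sum_(j < n) L i j *: q j k w).
    by apply/funext => w; case: (halg w) => _ _ _ _ _ _ ->.
  apply: coord_measurableD; first exact: mb.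
  apply: coord_measurableZ.
  by apply: coord_measurableB; [exact: mq|exact: mLq].
- have -> : v i k.+1 = fun w => v i k w + (eta * beta) *:
      (a i k w - b i k w + \sum_(j < n) L i j *: q j k w).
    by apply/funext => w; case: (halg w) => _ _ _ _ _ _ _ _ ->.
  apply: coord_measurableD; first exact: mv.
  by apply: coord_measurableZ; exact: mc.
Qed.

End adapted.

Section measurable_stack.
Context {R : realType} {n d : nat} {dT : measure_display}.
Context {T : measurableType dT}.
Implicit Types u : 'I_n -> T -> 'rV[R]_d.

Lemma coord_measurable_stack u : (forall i, coord_measurable (u i)) ->
  coord_measurable (fun w => stack (fun i => u i w)).
Proof. by move=> mu i j; under eq_fun do rewrite mxE; exact: mu. Qed.

Lemma coord_measurable_mean_vec u : (forall i, coord_measurable (u i)) ->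
  coord_measurable (fun w => mean_vec (fun i => u i w)).
Proof.
by move=> mu; apply: coord_measurableZ; exact: coord_measurable_sum.
Qed.

Lemma integral_dot_stack (m : {measure set T -> \bar R}) u :
  (forall i, coord_measurable (u i)) ->
  (\int[m]_w (dot (stack (fun i => u i w)) (stack (fun i => u i w)))%:E =
   \sum_(i < n) \int[m]_w (dot (u i w) (u i w))%:E)%E.
Proof.
move=> mu; rewrite -ge0_integral_sum //; last 2 first.
- by move=> i; apply/measurable_EFinP; exact: measurable_dot.
- by move=> i w _; rewrite lee_fin dot_ge0.
by apply: eq_integral => w _; rewrite dot_stack sumEFin.
Qed.

End measurable_stack.

(** * Summation of the expected dissipation *)

Section convergence.
Context {R : realType} {n d : nat}.
Variable A : 'M[R]_n.
Hypothesis n_ge2 : (2 <= n)%N.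
Hypothesis hA : connected_weighted_graph A.
Variables (f : 'I_n -> 'rV[R]_d -> R) (Lf fstar : R).
Hypothesis Lf_gt0 : 0 < Lf.
Hypothesis hdiff : forall i x, differentiable (f i) x.
Hypothesis hlip : forall i x y,
  enorm (grad (f i) x - grad (f i) y) <= Lf * enorm (x - y).
Hypothesis hfstar : is_minimum (mean_fun f) fstar.
Context {dS : measure_display} {S : measurableType dS}.
Variables (mu : probability S R) (C : S -> 'rV[R]_d -> 'rV[R]_d) (phi r : R).
Hypotheses (hphi : 0 < phi <= 1) (hr : 0 < r).
Hypothesis hC : compressor mu C phi r.
Context {dO : measure_display} {Omega : measurableType dO}.
Variables (P : probability Omega R) (xi : 'I_n -> nat -> Omega -> S).
Hypothesis hxi : fresh_seeds P mu xi.
Variables kappa1 kappa4 alpha beta eta psi : R.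
Hypothesis hkappa4 : 0 < kappa4.
Local Notation L := (laplacian A).
Local Notation J := (@avg_mx R n).
Local Notation rho := (spectral_radius L).
Local Notation rho2 := (min_pos_eigenvalue L).
Hypothesis hkappa1 : kappa1_bound rho2 kappa4 <= kappa1.
Hypothesis halpha : alpha = kappa1 * beta.
Hypothesis hbeta : kappa2 rho2 Lf kappa1 kappa4 < beta.
Hypothesis hpsi : 0 < psi <= r^-1.
Hypothesis heta : 0 < eta < kappa3 rho rho2 Lf phi r alpha beta psi.
Variables (x0 : 'I_n -> 'rV[R]_d).
Variables (a b v x q : 'I_n -> nat -> Omega -> 'rV[R]_d).
Hypothesis halg : forall w, compressed_primal_dual L f alpha beta eta psi
     (fun i k => C (xi i k w)) x0
     (fun i k => a i k w) (fun i k => b i k w) (fun i k => v i k w)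
     (fun i k => x i k w) (fun i k => q i k w).
Variable Li : 'M[R]_n.
Hypothesis LiL : Li *m L = 1%:M - J.
Hypothesis LLi : L *m Li = 1%:M - J.
Hypothesis JLi : J *m Li = 0.

Local Notation c := (phi * psi * r).

Let pot k w := potential A Li f fstar kappa1 beta
  (fun i k => v i k w) (fun i k => x i k w) k.
Let dis k w := dissipation A f Lf phi r alpha beta eta psi
  (fun i k => x i k w) k.
Let err k w := dot (stack (fun i => x i k w) - stack (fun i => a i k w))
                   (stack (fun i => x i k w) - stack (fun i => a i k w)).

Let hlip2 i y z :
  dot (grad (f i) y - grad (f i) z) (grad (f i) y - grad (f i) z)
  <= Lf ^+ 2 * dot (y - z) (y - z).
Proof. exact: grad_lip. Qed.

Let iterates k i := adapted_iterates hC hlip2 halg k i.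

Let mx i k : coord_measurable (x i k).
Proof.
by have [h _ _ _] := iterates k i; exact: (adapted_measurable hxi h).
Qed.
Let ma i k : coord_measurable (a i k).
Proof.
by have [_ h _ _] := iterates k i; exact: (adapted_measurable hxi h).
Qed.
Let mv i k : coord_measurable (v i k).
Proof.
by have [_ _ _ h] := iterates k i; exact: (adapted_measurable hxi h).
Qed.
Let mq i k : coord_measurable (q i k).
Proof.
apply: (@adapted_measurable R n _ _ _ _ P mu xi hxi k.+1).
by apply: (adapted_q hC halg) => l; have [] := iterates k l.
Qed.
Let mxbar k : coord_measurable (fun w => mean_vec (fun i => x i k w)).
Proof. exact: coord_measurable_mean_vec. Qed.

Let mgradbar k : coord_measurable (fun w => gradbar f (fun i k => x i k w) k).
Proof.
apply: coord_measurable_stack => i.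
exact: (coord_measurable_grad hlip2).
Qed.

Let mF k :
  measurable_fun [set: Omega]
    (fun w => mean_fun f (mean_vec (fun i => x i k w))).
Proof.
apply: measurable_funM => //; apply: measurable_sum => i.
apply: measurable_continuous => // y.
exact: differentiable_continuous.
Qed.

Let mpot k : measurable_fun [set: Omega] (pot k).
Proof.
have mz : coord_measurable (fun w => center (stack (fun i => x i k w))).
  by apply: coord_measurable_mulmx; exact: coord_measurable_stack.
have ms : coord_measurable (fun w => Li *m (stack (fun i => v i k w)
    + beta^-1 *: gradbar f (fun i k => x i k w) k)).
  apply: coord_measurable_mulmx; apply: coord_measurableD.
    exact: coord_measurable_stack.
  exact: coord_measurableZ.
apply: measurable_funD; last first.
  by apply: measurable_funM => //; exact: measurable_funB.
apply: measurable_funD; last exact: measurable_dot.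
apply: measurable_funD.
  by apply: measurable_funM => //; exact: measurable_dot.
apply: measurable_funM => //; apply: measurable_dot => //.
exact: coord_measurable_mulmx.
Qed.

Let mdis k : measurable_fun [set: Omega] (dis k).
Proof.
apply: measurable_funD; apply: measurable_funM => //; apply: measurable_dot;
  apply: coord_measurable_mulmx => //; exact: coord_measurable_stack.
Qed.

Let merr k : measurable_fun [set: Omega] (err k).
Proof.
by apply: measurable_dot; apply: coord_measurableB;
  exact: coord_measurable_stack.
Qed.

Let gain := compression_gain A phi r alpha beta eta psi.

Let rho2_gt0 : 0 < rho2.
Proof. by have [] := laplacian_bounds n_ge2 hA. Qed.
Let rho2_le : rho2 <= rho.
Proof. by have [] := laplacian_bounds n_ge2 hA. Qed.

(** The saddle part is nonnegative: [kappa1] is at least 9 / 2 / rho2, and the dual variable has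
    mean zero, being in the range of [Li]. *)
Let pot_ge k w : n%:R * (mean_fun f (mean_vec (fun i => x i k w)) - fstar)
  <= pot k w.
Proof.
rewrite lerDr; apply: (@saddle_ge0 _ _ _ _ rho2) => //.
- exact: dot_laplacian_ge0.
- have [k1 k2] := kappa1_ge rho2_gt0 hkappa4 hkappa1.
    apply: (@le_trans _ _ (9 / 2 / rho2)); last exact: ler_wpDr.
  rewrite ler_peMl ?invr_ge0 ?(ltW rho2_gt0) //; lra.
have [_ _ _ _ gap] := laplacian_bounds n_ge2 hA.
by apply: gap; rewrite mulmxA JLi mul0mx.
Qed.

Let F_ge0 k w : 0 <= mean_fun f (mean_vec (fun i => x i k w)) - fstar.
Proof. by have [_ h] := hfstar; rewrite subr_ge0. Qed.

Let pot_ge0 k w : 0 <= pot k w.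
Proof. by apply: le_trans (pot_ge k w); rewrite mulr_ge0. Qed.

Let rate_gt0 : 0 < consensus_rate A Lf phi r alpha beta eta psi.
Proof.
case/andP: (heta) => eta0 _; apply: mulr_gt0 => //.
exact: (consensus_margin rho2_gt0 rho2_le Lf_gt0 hphi hr hpsi hkappa4 hkappa1
  halpha hbeta heta).
Qed.

Let dis_ge0 k w : 0 <= dis k w.
Proof.
case/andP: (heta) => eta0 _.
by rewrite addr_ge0 // mulr_ge0 ?dot_ge0 // ltW // divr_gt0.
Qed.

Let gain_ge0 : 0 <= gain.
Proof.
exact: (compression_gain_ge0 n_ge2 hA hphi hr hpsi hkappa4 hkappa1 halpha
  hbeta heta).
Qed.

Lemma integral_compression k :
  (\int[P]_w (dot (stack (fun i => a i k w) + stack (fun i => q i k w)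
                   - stack (fun i => x i k w))
                  (stack (fun i => a i k w) + stack (fun i => q i k w)
                   - stack (fun i => x i k w)))%:E
   <= (r_zero phi r)%:E * \int[P]_w (err k w)%:E)%E.
Proof.
under eq_integral do rewrite stackD stackB.
under [in leRHS]eq_integral do rewrite /err stackB.
rewrite !integral_dot_stack; last 2 first.
- by move=> i; exact: coord_measurableB.
- by move=> i; apply: coord_measurableB => //; exact: coord_measurableD.
rewrite ge0_sume_distrr => [|i _]; last first.
  by apply: integral_ge0 => w _; rewrite lee_fin dot_ge0.
apply: lee_sum => i _.
have E w : a i k w + q i k w - x i k w =
    1 *: C (xi i k w) (x i k w - a i k w) + -1 *: (x i k w - a i k w).
  rewrite (q_compressed (halg w)) scale1r scaleN1r opprB.
  by rewrite [a i k w + _]addrC addrA.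
under eq_integral do rewrite E.
have [ix ia _ _] := iterates k i; case/andP: hphi => _ phi1.
apply: (integral_compressor hxi hC phi1 i (A := 2 * r ^+ 2)
  (B := 2 * (1 - r) ^+ 2) (coord_measurableB ix ia)).
- by rewrite mulr_ge0 ?sqr_ge0.
- by rewrite mulr_ge0 ?sqr_ge0.
move=> u y.
(* The compressor bound concerns C(y) / r, so C(y) - y splits into r times that error and the
   scaling defect (r - 1) y; doubling the two squares produces r_0. *)
have -> : 1 *: u + -1 *: y = r *: (r^-1 *: u - y) + (r - 1) *: y.
  rewrite scalerBr scalerA divff ?gt_eqF // scalerBl !scale1r scaleN1r.
  by rewrite addrA subrK.
move: (r^-1 *: u - y) => e.
have := dot_ge0 (r *: e - (r - 1) *: y).
rewrite !dot_sqrD !(dotNl, dotNr, dotZl, dotZr); lra.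
Qed.

Lemma integral_contraction k :
  (\int[P]_w (dot (stack (fun i => x i k w) - (stack (fun i => a i k w)
                    + psi *: stack (fun i => q i k w)))
                  (stack (fun i => x i k w) - (stack (fun i => a i k w)
                    + psi *: stack (fun i => q i k w))))%:E
   <= (1 - c)%:E * \int[P]_w (err k w)%:E)%E.
Proof.
under eq_integral do rewrite stackZ stackD stackB.
under [in leRHS]eq_integral do rewrite /err stackB.
rewrite !integral_dot_stack; last 2 first.
- by move=> i; exact: coord_measurableB.
- move=> i; apply: coord_measurableB => //; apply: coord_measurableD => //.
  exact: coord_measurableZ.
rewrite ge0_sume_distrr => [|i _]; last first.
  by apply: integral_ge0 => w _; rewrite lee_fin dot_ge0.
apply: lee_sum => i _.
have E w : x i k w - (a i k w + psi *: q i k w) =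
    - psi *: C (xi i k w) (x i k w - a i k w) + 1 *: (x i k w - a i k w).
  by rewrite (q_compressed (halg w)) scale1r scaleNr opprD addrA [RHS]addrC.
under eq_integral do rewrite E.
have [ix ia _ _] := iterates k i; case/andP: (hphi) => _ phi1.
case/andP: (hpsi) => psi0 psir.
have pr1 : 0 <= 1 - psi * r by rewrite subr_ge0 -ler_pdivlMr // div1r.
have pr0 : 0 <= psi * r by rewrite mulr_ge0 // ltW.
have -> : 1 - c = psi * r * (1 - phi) + (1 - psi * r) by ring.
apply: (integral_compressor hxi hC phi1 i (coord_measurableB ix ia)) => //.
move=> u y.
(* As psi r <= 1, this is a convex combination of minus the compression error and y. Convexity of
   the square, whose defect is psi r (1 - psi r) |e + y|^2, gives the factor psi r (1 - phi) + 1 -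
   psi r. *)
have -> : - psi *: u + 1 *: y =
    - (psi * r) *: (r^-1 *: u - y) + (1 - psi * r) *: y.
  rewrite scalerBr scalerA mulNr mulfK ?gt_eqF // scalerBl -addrA.
  congr (_ + _).
  by rewrite scaleNr opprK addrC subrK.
move: (r^-1 *: u - y) => e.
have := dot_ge0 (e + y).
rewrite !dot_sqrD !(dotNl, dotNr, dotZl, dotZr).
move=> /(mulr_ge0 (mulr_ge0 pr0 pr1)); lra.
Qed.

Lemma integral_potential_step k :
  (\int[P]_w (pot k.+1 w + err k.+1 w)%:E + \int[P]_w (dis k w)%:E <=
   \int[P]_w (pot k w + err k w)%:E)%E.
Proof.
have /andP[c0 c1] := rate_bounds hphi hr hpsi.
have ms (u : 'I_n -> nat -> Omega -> 'rV[R]_d) :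
    (forall i k, coord_measurable (u i k)) ->
    coord_measurable (fun w => stack (fun i => u i k w)).
  by move=> hu; exact: coord_measurable_stack.
have me1 : coord_measurable (fun w => stack (fun i => a i k w)
    + stack (fun i => q i k w) - stack (fun i => x i k w)).
  apply: coord_measurableB; last exact: ms.
  by apply: coord_measurableD; exact: ms.
have me2 : coord_measurable (fun w => stack (fun i => x i k w)
    - (stack (fun i => a i k w) + psi *: stack (fun i => q i k w))).
  apply: coord_measurableB; first exact: ms.
  by apply: coord_measurableD; [exact: ms|apply: coord_measurableZ; exact: ms].
apply: (ge0_integral_descent (h := 1 + c / 2) (mpot k) (mpot k.+1)
  (merr k) (merr k.+1) (mdis k) _ _ (pot_ge0 k) (pot_ge0 k.+1) _ _ (dis_ge0 k)
  _ _ gain_ge0 _ (r_zero_ge0 r hphi) _ _ (integral_compression k)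
  (integral_contraction k)).
- exact: measurable_dot.
- exact: measurable_dot.
- by move=> w; exact: dot_ge0.
- by move=> w; exact: dot_ge0.
- by move=> w; exact: dot_ge0.
- by move=> w; exact: dot_ge0.
- by rewrite addr_ge0 // divr_ge0 // ltW.
- by rewrite subr_ge0.
- move=> w; exact: (potential_step n_ge2 hA LiL LLi JLi fstar Lf_gt0 hdiff hlip
    hphi hr hpsi hkappa4 hkappa1 halpha hbeta heta (halg w) k).
exact: (compression_margin rho2_gt0 rho2_le hphi hr hpsi hkappa4 hkappa1
  halpha hbeta heta).
Qed.

(** The dissipated terms stay on the left, so telescoping subtracts no possibly infinite
    integral. *)
Lemma integral_potential_sum T :
  (\int[P]_w (pot T w + err T w)%:E
   + \sum_(0 <= k < T) \int[P]_w (dis k w)%:E <=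
   \int[P]_w (pot 0%N w + err 0%N w)%:E)%E.
Proof.
elim: T => [|T IHT]; first by rewrite big_geq // adde0.
apply: le_trans IHT; rewrite big_nat_recr //= addeCA [leLHS]addeC.
by rewrite leeD2r // integral_potential_step.
Qed.

(** The initial x, a, v are deterministic and q does not occur in the integrand, which is therefore
    constant. Finiteness of all later expectations rests on this. *)
Lemma integral_potential0 : exists M : R,
  (\int[P]_w (pot 0%N w + err 0%N w)%:E)%E = M%:E.
Proof.
pose w0 : Omega := point.
exists (pot 0%N w0 + err 0%N w0).
rewrite (eq_integral (fun=> (pot 0%N w0 + err 0%N w0)%:E)) => [|w _].
  by rewrite integral_cst //= (@probability_setT _ _ _ P) mule1.
have xE : (fun i => x i 0%N w) = fun i => x i 0%N w0.
  by apply/funext => i; case: (halg w) => ->; case: (halg w0) => ->.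
have aE : (fun i => a i 0%N w) = fun i => a i 0%N w0.
  by apply/funext => i; case: (halg w) => _ ->; case: (halg w0) => _ ->.
have vE : (fun i => v i 0%N w) = fun i => v i 0%N w0.
  apply/funext => i.
  by case: (halg w) => _ _ _ ->; case: (halg w0) => _ _ _ ->.
by rewrite /pot /err /potential /gradbar xE aE vE.
Qed.

Let F := mean_fun f.
Let xbar k w := mean_vec (fun i => x i k w).

Lemma consensus_error_bounded : bigO_one (fun T =>
  (\sum_(0 <= k < T.+1) \sum_(i < n)
    'E_P[fun w => (enorm (x i k w - xbar k w) ^+ 2
                   + enorm (grad F (xbar k w)) ^+ 2)%R])%E).
Proof.
have [M ME] := integral_potential0.
case/andP: (heta) => eta0 _.
pose cr := consensus_rate A Lf phi r alpha beta eta psi.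
have cr0 : 0 < cr := rate_gt0.
(* One summand inverts each of the two coefficients of the dissipation; the mixed products are
   nonnegative and are dropped. *)
pose K := cr^-1 + 2 / eta.
have K0 : 0 <= K by rewrite addr_ge0 ?invr_ge0 ?divr_ge0 // ltW.
exists (K * M) => T.
have sumE k : (\sum_(i < n) 'E_P[fun w => (enorm (x i k w - xbar k w) ^+ 2
                   + enorm (grad F (xbar k w)) ^+ 2)%R] <=
    K%:E * \int[P]_w (dis k w)%:E)%E.
  have mterm i : measurable_fun [set: Omega] (fun w =>
      enorm (x i k w - xbar k w) ^+ 2 + enorm (grad F (xbar k w)) ^+ 2).
    apply: measurable_funD.
      under eq_fun do rewrite enorm_sqr.
      by apply: measurable_dot; apply: coord_measurableB;
        exact: mx || exact: mxbar.
    under eq_fun do rewrite grad_mean_fun // enorm_sqr.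
    by apply: measurable_dot; apply: coord_measurable_mean_vec => j;
      apply: (coord_measurable_grad hlip2); exact: mxbar.
  under eq_bigr do rewrite unlock.
  rewrite -ge0_integral_sum //; last 2 first.
  - by move=> i; exact/measurable_EFinP.
  - by move=> i w _; rewrite lee_fin addr_ge0 ?sqr_ge0.
  rewrite -ge0_integralZl_EFin //; last 2 first.
  - by move=> w _; rewrite lee_fin.
  - exact/measurable_EFinP.
  have sumD w : \sum_(i < n) (enorm (x i k w - xbar k w) ^+ 2
        + enorm (grad F (xbar k w)) ^+ 2) <= K * dis k w.
    rewrite big_split /=.
    under eq_bigr do rewrite enorm_sqr.
    under [X in _ + X]eq_bigr do rewrite grad_mean_fun // enorm_sqr.
    rewrite -!dot_stack -center_stack -avg_stack.
    rewrite -/(gradbar f (fun i k => x i k w) k) /dis /dissipation -/cr.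
    have := dot_ge0 (center (stack (fun i => x i k w))).
    have := dot_ge0 (J *m gradbar f (fun i k => x i k w) k).
    move: (dot _ _) (dot _ _) => z u u0 z0.
    have i0 : 0 <= cr^-1 by rewrite invr_ge0 ltW.
    have i1 : 0 <= 2 / eta by rewrite divr_ge0 // ltW.
    have -> : K * (cr * z + eta / 2 * u) =
        z + u + 2 / eta * (cr * z) + cr^-1 * (eta / 2 * u).
      by rewrite /K; field; rewrite !gt_eqF.
    by rewrite -addrA lerDl addr_ge0 // mulr_ge0 // mulr_ge0 // ltW // divr_gt0.
  apply: ge0_le_integral => //.
  - by move=> w _; apply: sume_ge0 => i _; rewrite lee_fin addr_ge0 ?sqr_ge0.
  - by apply: emeasurable_sum => i; exact/measurable_EFinP.
  - by apply: measurable_funeM; exact/measurable_EFinP.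
  by move=> w _; rewrite sumEFin -EFinM lee_fin.
rewrite gee0_abs; last first.
  apply: sume_ge0 => k _; apply: sume_ge0 => i _; apply: expectation_ge0 => w.
  by rewrite addr_ge0 ?sqr_ge0.
apply: (@le_trans _ _ (\sum_(0 <= k < T.+1) K%:E * \int[P]_w (dis k w)%:E)%E).
  by apply: lee_sum => k _; exact: sumE.
rewrite -ge0_sume_distrr => [|k _]; last first.
  by apply: integral_ge0 => w _; rewrite lee_fin.
rewrite EFinM lee_wpmul2l // -ME.
apply: le_trans (integral_potential_sum T.+1).
rewrite leeDr //; apply: integral_ge0 => w _.
by rewrite lee_fin addr_ge0 // dot_ge0.
Qed.

Lemma optimality_gap_bounded :
  bigO_one (fun T => ('E_P[fun w => (F (xbar T w) - fstar)%R])%E).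
Proof.
have [M ME] := integral_potential0.
exists M => T; rewrite gee0_abs; last first.
  by apply: expectation_ge0 => w; exact: F_ge0.
rewrite unlock -ME; apply: le_trans (integral_potential_sum T).
apply: (@le_trans _ _ (\int[P]_w (pot T w + err T w)%:E)%E); last first.
  rewrite leeDl //; apply: sume_ge0 => k _; apply: integral_ge0 => w _.
  by rewrite lee_fin.
apply: ge0_le_integral => //.
- by move=> w _; rewrite lee_fin; exact: F_ge0.
- apply/measurable_EFinP; apply: measurable_funB => //; exact: mF.
- apply/measurable_EFinP.
  by apply: measurable_funD; [exact: mpot|exact: merr].
move=> w _; rewrite lee_fin.
apply: (@le_trans _ _ (pot T w)); last by rewrite lerDl dot_ge0.
apply: le_trans (pot_ge T w); apply: ler_peMl; first exact: F_ge0.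
by rewrite ler1n ltnW.
Qed.

End convergence.

Theorem theorem1 (R : realType) (n d : nat) (hn : (2 <= n)%N)
  (A : 'M[R]_n) (hA : connected_weighted_graph A)
  (f : 'I_n -> 'rV[R]_d -> R) (Lf : R) (hLf : 0 < Lf)
  (hdiff : forall i x, differentiable (f i) x)
  (hlip : forall i x y,
     enorm (grad (f i) x - grad (f i) y) <= Lf * enorm (x - y))
  (fstar : R)
  (hfstar : is_minimum (mean_fun f) fstar)
  (dS : measure_display) (S : measurableType dS) (mu : probability S R)
  (C : S -> 'rV[R]_d -> 'rV[R]_d) (phi r : R)
  (hphi : 0 < phi <= 1) (hr : 0 < r)
  (hC : compressor mu C phi r)
  (dO : measure_display) (Omega : measurableType dO) (P : probability Omega R)
  (xi : 'I_n -> nat -> Omega -> S) (hxi : fresh_seeds P mu xi)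
  (kappa1 kappa4 alpha beta eta psi : R)
  (hkappa4 : 0 < kappa4)
  (hkappa1 : kappa1_bound (min_pos_eigenvalue (laplacian A)) kappa4 <= kappa1)
  (halpha : alpha = kappa1 * beta)
  (hbeta : kappa2 (min_pos_eigenvalue (laplacian A)) Lf kappa1 kappa4 < beta)
  (hpsi : 0 < psi <= r^-1)
  (heta : 0 < eta < kappa3 (spectral_radius (laplacian A))
                      (min_pos_eigenvalue (laplacian A))
                      Lf phi r alpha beta psi)
  (x0 : 'I_n -> 'rV[R]_d)
  (a b v x q : 'I_n -> nat -> Omega -> 'rV[R]_d)
  (halg : forall w, compressed_primal_dual (laplacian A) f alpha beta eta psi
     (fun i k => C (xi i k w)) x0
     (fun i k => a i k w) (fun i k => b i k w) (fun i k => v i k w)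
     (fun i k => x i k w) (fun i k => q i k w)) :
  let F := mean_fun f in
  let xbar := fun k w => mean_vec (fun i => x i k w) in
  bigO_one (fun T => (\sum_(0 <= k < T.+1) \sum_(i < n)
    'E_P[fun w => (enorm (x i k w - xbar k w) ^+ 2
                   + enorm (grad F (xbar k w)) ^+ 2)%R])%E)
  /\ bigO_one (fun T => ('E_P[fun w => (F (xbar T w) - fstar)%R])%E).
Proof.
move=> F xbar.
have [Li [LiL LLi _ JLi]] := laplacian_pinv hn hA.
split.
  exact: (consensus_error_bounded hn hA hLf hdiff hlip hfstar hphi hr hC hxi
    hkappa4 hkappa1 halpha hbeta hpsi heta halg LiL LLi JLi).
exact: (optimality_gap_bounded hn hA hLf hdiff hlip hfstar hphi hr hC hxi
  hkappa4 hkappa1 halpha hbeta hpsi heta halg LiL LLi JLi).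
Qed.
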